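(* Let $\Omega\subset\mathbb{R}^n$ be an open neighbourhood of the origin and let $H=T+\Pi$ be a Hamiltonian function on $\Omega\times\mathbb{R}^n$, where $T(q,p)=\frac12\langle B(q)p,p\rangle$ is of class $\mathcal{C}^2$ with $B(q)$ a symmetric positive definite $n\times n$ matrix for each $q\in\Omega$, and the potential energy $\Pi:\Omega\to\mathbb{R}$ is of class $\mathcal{C}^2$ with $\Pi(0)=0$ and a critical point at $0$. If there are $\varepsilon>0$ with $B_\varepsilon\subset\Omega$ and a connected component $C$ of $\Pi^{-1}((-\infty,0))$ with $0\in\overline{C}$ such that $\langle\nabla\Pi(q),q\rangle<0$ for all $q\in(\overline{C}\setminus\{0\})\cap B_\varepsilon$, then there is an asymptotic motion to the equilibrium $(0,0)$ of the Hamiltonian equations $\dot q=\frac{\partial H}{\partial p}(q,p)$, $\dot p=-\frac{\partial H}{\partial q}(q,p)$.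
   Context: $B_\varepsilon$ denotes the open Euclidean ball of $\mathbb{R}^n$ with centre $0$ and radius $\varepsilon$. An asymptotic motion (asymptotic trajectory) to the equilibrium $(0,0)$ is a nonconstant solution $(q(t),p(t))$ of the Hamiltonian equations, defined for all $t\le 0$, with $\lim_{t\to-\infty}(q(t),p(t))=(0,0)$. (By the reversibility $(q(t),p(t))\mapsto(q(-t),-p(-t))$ of these equations this is equivalent to the existence of a nonconstant solution tending to $(0,0)$ as $t\to+\infty$.) *)

(* Defs.v *)
From HB Require Import structures.
From mathcomp Require Import all_boot all_order all_algebra.
From mathcomp Require Import all_classical all_reals all_analysis.

Set Implicit Arguments.
Unset Strict Implicit.
Unset Printing Implicit Defensive.

Import Order.TTheory GRing.Theory Num.Theory.
Import numFieldNormedType.Exports.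

Local Open Scope classical_set_scope.
Local Open Scope ring_scope.

Definition dotv (R : realType) (n : nat) (u v : 'rV[R]_n) : R :=
  \sum_(i < n) u 0 i * v 0 i.

(* The library norm on row vectors is the sup norm, hence the explicit
   Euclidean norm; both induce the same topology. *)
Definition eball (R : realType) (n : nat) (r : R) : set 'rV[R]_n :=
  [set x | Num.sqrt (dotv x x) < r].

(* Meant for open U: f is Frechet differentiable at every point of U and all
   its directional derivatives are again of class C^(k-1) on U. In finite
   dimension this is the usual class C^k. *)
Fixpoint class_C (R : realType) (V : normedModType R) (k : nat)
    (U : set V) (f : V -> R) : Prop :=
  match k with
  | 0%N => forall x, U x -> {for x, continuous f}
  | k'.+1 => (forall x, U x -> differentiable f x) /\
             (forall v : V, class_C k' U ('D_v f))
  end.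

Definition gradient (R : realType) (n : nat) (f : 'rV[R]_n -> R)
    (x : 'rV[R]_n) : 'rV[R]_n :=
  \row_(i < n) 'D_(delta_mx 0 i) f x.

Definition symmetric_mx (R : realType) (n : nat) (M : 'M[R]_n) : Prop :=
  M^T = M.

(* Vectors are rows, so the vector "M v" is v *m M^T. *)
Definition mxapp (R : realType) (n : nat) (M : 'M[R]_n) (v : 'rV[R]_n) :
    'rV[R]_n :=
  v *m M^T.

Definition posdef_mx (R : realType) (n : nat) (M : 'M[R]_n) : Prop :=
  forall v : 'rV[R]_n, v != 0 -> 0 < dotv (mxapp M v) v.

Definition kinetic (R : realType) (n : nat) (B : 'rV[R]_n -> 'M[R]_n)
    (z : 'rV[R]_n * 'rV[R]_n) : R :=
  2^-1 * dotv (mxapp (B z.1) z.2) z.2.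

Definition hamiltonian (R : realType) (n : nat) (B : 'rV[R]_n -> 'M[R]_n)
    (Pi : 'rV[R]_n -> R) (z : 'rV[R]_n * 'rV[R]_n) : R :=
  kinetic B z + Pi z.1.

Definition is_component (T : topologicalType) (A C : set T) : Prop :=
  exists2 x, A x & C = connected_component A x.

(* Functions on Omega are represented by total functions whose values outside
   Omega are irrelevant; solutions on I must therefore stay in Omega. The
   functions q and p are total too: at an end point of I, asking for the
   two-sided derivative rather than the one-sided one does not affect the
   existence of a solution, as a one-sided solution can be prolonged affinely
   beyond the end point. *)
Definition hamilton_solution (R : realType) (n : nat) (Omega : set 'rV[R]_n)
    (H : 'rV[R]_n * 'rV[R]_n -> R) (I : set R) (q p : R -> 'rV[R]_n) : Prop :=
  forall t : R, I t ->
    [/\ Omega (q t),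
        is_derive t 1 q (gradient (fun y => H (q t, y)) (p t)) &
        is_derive t 1 p (- gradient (fun x => H (x, p t)) (q t))].

(* Nonconstancy is on ]-oo, 0] only, the values at t > 0 being irrelevant. *)
Definition asymptotic_motion (R : realType) (n : nat) (Omega : set 'rV[R]_n)
    (H : 'rV[R]_n * 'rV[R]_n -> R) (q p : R -> 'rV[R]_n) : Prop :=
  [/\ hamilton_solution Omega H [set t | t <= 0] q p,
      exists s t : R, [/\ s <= 0, t <= 0 & (q s, p s) <> (q t, p t)] &
      (q t, p t) @[t --> -oo] --> ((0, 0) : 'rV[R]_n * 'rV[R]_n)].

(* Main.v *)
Require Import Defs.
From HB Require Import structures.
From mathcomp Require Import all_boot all_order all_algebra.
From mathcomp Require Import all_classical all_reals all_analysis.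
From mathcomp Require Import ring lra.

Import Order.TTheory GRing.Theory Num.Theory.
Import numFieldNormedType.Exports.

Local Open Scope classical_set_scope.
Local Open Scope ring_scope.

(** The orbit is found on the zero energy level.  Let [A] be the set of states
    [(q, p)] with [q] in the closure of [C], [|q| <= r] and [H (q, p) = 0].
    Along a solution the virial [L = <q, p>] has the derivative
    [2 T - D_(q, 0) T - <grad Pi (q), q>] ([virial]).  Since [T] is positive
    definite in [p] and [D_(q, 0) T] is of order [|q| |p|^2], for small [r] this is
    at least [T - <grad Pi (q), q>], which on [A] is positive except at the
    origin ([virial_rate_gt0]).

    A solution in [A] with [L > 0] therefore keeps away from the origin, [L]
    grows at least linearly, and as [A] is compact the solution must leave [A].
    It can do so only through [|q| = r]: conservation of energy gives
    [Pi (q) = - T <= 0], and close to a nonzero point of the closure of [C] every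
    point where [Pi <= 0] belongs to that closure, because it can be pushed
    along the radial direction, in which [Pi] decreases, into the open sublevel
    set and joined there to [C] ([closure_component_nbhs],
    [energy_level_continues]).

    Start at [(q, l q)] with [q] in [C] near the origin and [l > 0] such that
    [H = 0] ([energy_level_small]).  The origin is an equilibrium, so the closer
    the start, the longer the orbit needs to reach [|q| = r].  Count time from
    the exit; by compactness the exit points accumulate, and by continuous
    dependence on the initial state the solution through a limit point stays in
    [A] for all [t <= 0] ([entire_orbit]).  There [L] is monotone and bounded while
    its derivative is bounded below away from the origin, so that the solution
    tends to the origin at [-oo] ([backward_asymptotic]).

    The flow is obtained by Picard iteration ([picard]).  To have a bounded
    and globally Lipschitz field, the Hamiltonian field is composed with the
    retraction of the phase space onto a box that contains [A]
    ([clamped_field]). *)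

Set Implicit Arguments.
Unset Strict Implicit.
Unset Printing Implicit Defensive.

(** * Calculus of functions of a real variable *)

Lemma is_derive_cont (R : realType) (f : R -> R) (t d : R) :
  is_derive t 1 f d -> {for t, continuous f}.
Proof. by move=> fd; apply/differentiable_continuous/derivable1_diffP. Qed.

Lemma mean_value (R : realType) (f df : R -> R) (a b : R) : a <= b ->
  (forall x, a <= x <= b -> is_derive x 1 f (df x)) ->
  exists2 c, a <= c <= b & f b - f a = df c * (b - a).
Proof.
move=> ab fd.
have [||c cab e] := @MVT_segment R f df a b ab.
- by move=> c; rewrite in_itv => /andP[/ltW ac /ltW cb]; apply: fd; rewrite ac cb.
- apply: continuous_in_subspaceT => x; rewrite inE/= in_itv/= => xab.
  exact: is_derive_cont (fd _ xab).
- by exists c => //; rewrite in_itv in cab.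
Qed.

Lemma derive_ge0_le (R : realType) (f df : R -> R) (a b : R) : a <= b ->
  (forall x, a <= x <= b -> is_derive x 1 f (df x)) ->
  (forall x, a <= x <= b -> 0 <= df x) -> f a <= f b.
Proof.
move=> ab fd df0; have [c cab e] := @mean_value R f df a b ab fd.
by rewrite -subr_ge0 e mulr_ge0 ?df0// subr_ge0.
Qed.

(** The integral from [- k.+1] to [x] is an antiderivative for [x > - k.+1].
    Normalized to vanish at 0, these functions agree wherever two of them are
    defined, and together they give one on the whole line. *)
Lemma antiderivative (R : realType) (f : R -> R) : continuous f ->
  exists F : R -> R, F 0 = 0 /\ forall x : R, is_derive x 1 F (f x).
Proof.
move=> cf.
have loc (a : R) : exists G : R -> R, forall x, a < x -> is_derive x 1 G (f x).
  pose G (x : R) := (\int[lebesgue_measure]_(t in `[a, x]) f t)%R.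
  exists G => x ax.
  have fi : lebesgue_measure.-integrable `[a, x + 1] (EFin \o f).
    apply: continuous_compact_integrable; first exact: segment_compact.
    exact: continuous_subspaceT.
  have [] := @continuous_FTC1_closed R f a x (x + 1) _ fi ax (cf x).
    by rewrite ltrDl.
  rewrite derive1E -/G => dG eG; exact: (DeriveDef dG eG).
have loc0 (k : nat) : exists G : R -> R, G 0 = 0 /\
    forall x : R, - k.+1%:R < x -> is_derive x 1 G (f x).
  have [G Gd] := loc (- k.+1%:R).
  exists (fun x => G x - G 0); split; first by rewrite subrr.
  move=> x kx; have Gx := Gd _ kx.
  have := is_deriveB Gx (@is_derive_cst _ _ _ (G 0) x 1).
  by rewrite subr0.
have [G GP] := choice loc0.
have Geq k l (x : R) : - k.+1%:R < x -> - l.+1%:R < x -> G k x = G l x.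
  move=> kx lx; have [Gk0 Gkd] := GP k; have [Gl0 Gld] := GP l.
  have D (y : R) : - k.+1%:R < y -> - l.+1%:R < y ->
      is_derive y 1 (fun y : R => G k y - G l y) (cst 0 y).
    move=> ky ly; have := is_deriveB (Gkd _ ky) (Gld _ ly).
    by rewrite subrr.
  have k0 : - k.+1%:R < 0 :> R by rewrite oppr_lt0.
  have l0 : - l.+1%:R < 0 :> R by rewrite oppr_lt0.
  have [x0|x0] := leP 0 x.
    have [|c _] := @mean_value R (fun y : R => G k y - G l y) (cst 0) 0 x x0.
      move=> y /andP[y0 _]; apply: D; [exact: lt_le_trans y0|exact: lt_le_trans y0].
    by rewrite mul0r Gk0 Gl0 subrr subr0 => /subr0_eq.
  have [|c _] := @mean_value R (fun y : R => G k y - G l y) (cst 0) x 0 (ltW x0).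
    move=> y /andP[y0 _]; apply: D; [exact: lt_le_trans y0|exact: lt_le_trans y0].
  by rewrite mul0r Gk0 Gl0 subrr sub0r => /eqP; rewrite oppr_eq0 subr_eq0 => /eqP.
have bnd (x : R) : exists k : nat, - k.+1%:R < x.
  exists (Num.bound x); rewrite ltrNl.
  have := archi_boundP (normr_ge0 x); rewrite -/(Num.bound _).
  have -> : Num.bound `|x| = Num.bound x by rewrite /Num.bound /= normr_id.
  move=> h; rewrite (le_lt_trans (ler_norm _))// normrN (lt_trans h)// ltr_nat//.
have [N NP] := choice bnd.
exists (fun x => G (N x) x); split; first by have [] := GP (N 0).
move=> x; have [_ /(_ _ (NP x)) Gx] := GP (N x).
apply: near_eq_is_derive Gx.
near=> y; apply: Geq => //.
near: y; exact: lt_nbhsr (NP x).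
Unshelve. all: by end_near. Qed.

(** The two-sided form, with [|t|] on the right, lets one bound serve both for
    the future and for the past of an orbit. *)
Lemma comparison (R : realType) (f df g dg : R -> R) :
  (forall t : R, is_derive t 1 f (df t)) ->
  (forall t : R, 0 <= t -> is_derive t 1 g (dg t)) ->
  `|f 0| <= g 0 -> (forall t : R, `|df t| <= dg `|t|) ->
  forall t : R, `|f t| <= g `|t|.
Proof.
have half (h dh : R -> R) (t : R) : (forall t : R, is_derive t 1 h (dh t)) ->
    (forall t : R, 0 <= t -> is_derive t 1 g (dg t)) ->
    `|h 0| <= g 0 -> (forall t : R, `|dh t| <= dg `|t|) -> 0 <= t -> h t <= g t.
  move=> hd gd h0 hb t0; rewrite -subr_ge0.
  apply: le_trans (_ : g 0 - h 0 <= _).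
    by rewrite subr_ge0 (le_trans (ler_norm _)).
  apply: (@derive_ge0_le R (fun t => g t - h t) (fun t => dg t - dh t)) => // x.
    by move=> /andP[x0 _]; apply: is_deriveB; first exact: gd.
  move=> /andP[x0 _]; rewrite subr_ge0 (le_trans (ler_norm _))//.
  by rewrite (le_trans (hb x))// ger0_norm.
have halfabs (h dh : R -> R) (t : R) : (forall t : R, is_derive t 1 h (dh t)) ->
    (forall t : R, 0 <= t -> is_derive t 1 g (dg t)) ->
    `|h 0| <= g 0 -> (forall t : R, `|dh t| <= dg `|t|) -> 0 <= t -> `|h t| <= g t.
  move=> hd gd h0 hb t0; rewrite ler_norml (half _ _ _ hd)// andbT lerNl.
  apply: (half (fun t => - h t) (fun t => - dh t)) => //.
  - by rewrite normrN.
  - by move=> s; rewrite normrN.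
move=> fd gd f0 dfg t.
have [t0|t0] := leP 0 t; first by rewrite [in leRHS]ger0_norm// (halfabs _ df).
rewrite [in leRHS]ltr0_norm// -[in leLHS](opprK t).
apply: (halfabs (fun s => f (- s)) (fun s => - df (- s))) => //.
- move=> s; have := is_derive1_comp (fd (- s)) (is_deriveNid s 1).
  by rewrite mulrN1.
- by rewrite oppr0.
- by move=> s; rewrite normrN (le_trans (dfg _))// normrN.
- by rewrite oppr_ge0 ltW.
Qed.

Lemma coord_norm_le (R : realType) (m : nat) (v : 'rV[R]_m) (i : 'I_m) :
  `|v 0 i| <= `|v|.
Proof.
rewrite [leRHS]/Num.Def.normr/= mx_normrE.
exact: (le_bigmax _ (fun k : 'I_1 * 'I_m => `|v k.1 k.2|) (0, i)).
Qed.

Lemma rv_norm_le (R : realType) (m : nat) (v : 'rV[R]_m) (a : R) : 0 <= a ->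
  (forall i, `|v 0 i| <= a) -> `|v| <= a.
Proof.
move=> a0 va; rewrite /Num.Def.normr/= mx_normrE; apply: bigmax_le => //.
by move=> [i j] _ /=; rewrite ord1.
Qed.

Lemma vec_comparison (R : realType) (m : nat) (u du : R -> 'rV[R]_m)
    (g dg : R -> R) :
  (forall (t : R) i, is_derive t 1 (fun s : R => u s 0 i) (du t 0 i)) ->
  (forall t : R, 0 <= t -> is_derive t 1 g (dg t)) ->
  `|u 0| <= g 0 -> (forall t : R, `|du t| <= dg `|t|) ->
  forall t : R, `|u t| <= g `|t|.
Proof.
move=> ud gd u0 dug t; apply: rv_norm_le.
  have d0 (s : R) : is_derive s 1 (cst (0 : R)) (cst 0 s) by exact: is_derive_cst.
  have h0 : `|cst (0 : R) (0 : R)| <= g 0 by rewrite /= normr0 (le_trans _ u0).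
  have h1 (s : R) : `|cst (0 : R) s| <= dg `|s|.
    by rewrite /= normr0 (le_trans _ (dug s)).
  by have := comparison d0 gd h0 h1 t; rewrite /= normr0.
move=> i; apply: (@comparison R (fun s => u s 0 i) (fun s => du s 0 i) g dg).
- exact: le_trans (coord_norm_le _ _) u0.
- by move=> s; exact: le_trans (coord_norm_le _ _) (dug s).
Qed.

Lemma is_derive_expZ (R : realType) (c a t : R) :
  is_derive t 1 (fun s : R => c * expR (a * s)) (c * a * expR (a * t)).
Proof.
have h : is_derive t 1 (fun s : R => a * s) a.
  have := is_deriveZ a (is_derive_id t (1 : R)).
  by rewrite /GRing.scale/= mulr1.
have := is_deriveZ c (is_derive1_comp (is_derive_expR (a * t)) h).
by rewrite /GRing.scale/= mulrAC mulrA.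
Qed.

Lemma vec_lipschitz (R : realType) (m : nat) (u du : R -> 'rV[R]_m) (M : R) :
  (forall (t : R) i, is_derive t 1 (fun s : R => u s 0 i) (du t 0 i)) ->
  (forall t, `|du t| <= M) ->
  forall s t, `|u t - u s| <= M * `|t - s|.
Proof.
move=> ud dM s t; have M0 : 0 <= M by exact: le_trans (dM 0).
wlog st : s t / s <= t.
  have [st|/ltW ts] := leP s t; first exact.
  by move=> /(_ _ _ ts); rewrite distrC [`|s - t|]distrC.
apply: rv_norm_le; first by rewrite mulr_ge0.
move=> i; rewrite !mxE.
have [c _ ->] := @mean_value R (fun r => u r 0 i) (fun r => du r 0 i) s t st
  (fun x _ => ud x i).
rewrite normrM.
by rewrite ler_wpM2r// (le_trans (coord_norm_le _ _)).
Qed.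

Lemma nbhs_dist (R : realType) (V : normedModType R) (x : V) (e : R) : 0 < e ->
  nbhs x [set y | `|y - x| < e].
Proof.
by move=> e0; apply/nbhs_normP; exists e => // y /=; rewrite distrC.
Qed.

Lemma lipschitz_cont (R : realType) (V W : normedModType R) (f : V -> W) (M : R) :
  (forall s t, `|f t - f s| <= M * `|t - s|) -> continuous f.
Proof.
move=> fM x; apply/cvgrPdist_lt => /= e e0.
have [M0|M0] := leP M 0.
  near=> y; rewrite distrC (le_lt_trans (fM _ _))// (le_lt_trans _ e0)//.
  by rewrite mulr_le0_ge0.
have eM : 0 < e / M by rewrite divr_gt0.
near=> y; rewrite distrC (le_lt_trans (fM _ _))// mulrC -ltr_pdivlMr//.
Unshelve. all: by end_near. Qed.

Definition solves (R : realType) (m : nat) (F : 'rV[R]_m -> 'rV[R]_m)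
    (z : R -> 'rV[R]_m) : Prop :=
  forall (t : R) i, is_derive t 1 (fun s : R => z s 0 i) (F (z t) 0 i).

Lemma integral_curve (R : realType) (m : nat) (f : R -> 'rV[R]_m) (y : 'rV[R]_m) :
  continuous f -> exists z : R -> 'rV[R]_m, z 0 = y /\
    forall (t : R) i, is_derive t 1 (fun s : R => z s 0 i) (f t 0 i).
Proof.
move=> cf.
have /choice[G GP] (i : 'I_m) : exists G : R -> R, G 0 = 0 /\
    forall x : R, is_derive x 1 G (f x 0 i).
  apply: antiderivative => x.
  apply: (@continuous_comp _ _ _ f (fun v : 'rV[R]_m => v 0 i)); first exact: cf.
  exact: coord_continuous.
exists (fun t => \row_i (y 0 i + G i t)); split.
  by apply/rowP => i; rewrite mxE (GP i).1 addr0.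
move=> t i; have [_ Gd] := GP i.
have -> : (fun s : R => (\row_i (y 0 i + G i s)) 0 i) = cst (y 0 i) + G i.
  by apply/funext => s; rewrite mxE.
by have := is_deriveD (is_derive_cst (y 0 i) t 1) (Gd t); rewrite add0r.
Qed.

Lemma is_deriveB_coord (R : realType) (m : nat) (a b da db : R -> 'rV[R]_m) :
  (forall (t : R) i, is_derive t 1 (fun s : R => a s 0 i) (da t 0 i)) ->
  (forall (t : R) i, is_derive t 1 (fun s : R => b s 0 i) (db t 0 i)) ->
  forall (t : R) i,
    is_derive t 1 (fun s : R => (a s - b s) 0 i) ((da t - db t) 0 i).
Proof.
move=> ad bd t i; rewrite !mxE.
have -> : (fun s : R => (a s - b s) 0 i) =
    (fun s : R => a s 0 i) - (fun s : R => b s 0 i).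
  by apply/funext => s; rewrite !mxE.
exact: is_deriveB (ad t i) (bd t i).
Qed.

(** * Ordinary differential equations with a bounded Lipschitz field *)

Lemma cauchy_geometric (R : realType) (m : nat) (u : nat -> 'rV[R]_m) (c : R) :
  (forall k, `|u k.+1 - u k| <= c * 2^-1 ^+ k) ->
  exists l : 'rV[R]_m, forall k, `|l - u k| <= 2 * c * 2^-1 ^+ k.
Proof.
move=> uc.
have c0 : 0 <= c by have := le_trans (normr_ge0 _) (uc 0); rewrite expr0 mulr1.
have tail k j : `|u (k + j)%N - u k| <= 2 * c * 2^-1 ^+ k - 2 * c * 2^-1 ^+ (k + j).
  elim: j => [|j IH]; first by rewrite addn0 !subrr normr0.
  rewrite addnS (le_trans (ler_distD (u (k + j)%N) _ _))//.
  apply: le_trans (lerD (uc _) IH) _; rewrite exprS le_eqVlt; apply/orP; left.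
  by apply/eqP; field.
have tail' k l : (k <= l)%N -> `|u l - u k| <= 2 * c * 2^-1 ^+ k.
  move=> /subnKC <-; apply: le_trans (tail _ _) _.
  by rewrite gerBl !mulr_ge0.
have lim0 : (2 * c * 2^-1 ^+ k : R) @[k --> \oo] --> (0 : R).
  have h : `|2^-1 : R| < 1 by rewrite ger0_norm ?invr_ge0// invf_lt1// ltr1n.
  exact: (@cvg_geometric _ (2 * c) 2^-1 h).
have cu : cvg (u @ \oo).
  apply: cauchy_cvg; apply: cauchy_exP => e e0.
  have /cvgrPdist_lt/(_ e e0)[N _ NP] := lim0.
  exists (u N), N => // k /= Nk.
  rewrite -ball_normE/= distrC (le_lt_trans (tail' _ _ Nk))//.
  by have := NP N (leqnn N); rewrite sub0r normrN ger0_norm// !mulr_ge0.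
exists (lim (u @ \oo)) => k.
have h : `|u l - u k| @[l --> \oo] --> `|lim (u @ \oo) - u k|.
  by apply: cvg_norm; apply: cvgB => //; exact: cvg_cst.
rewrite -(cvg_lim (@norm_hausdorff _ _) h); apply: limr_le.
  by apply/cvg_ex; eexists; exact: h.
by exists k => // l /= kl; exact: tail'.
Qed.

Lemma geometric_le0 (R : realType) (a c : R) :
  (forall k, a <= c * 2^-1 ^+ k) -> a <= 0.
Proof.
move=> ac.
have h : `|2^-1 : R| < 1 by rewrite ger0_norm ?invr_ge0// invf_lt1// ltr1n.
have h2 := @cvg_geometric _ c 2^-1 h.
rewrite -(cvg_lim (@norm_hausdorff _ _) h2); apply: limr_ge.
  by apply/cvg_ex; eexists; exact: h2.
by exists 0%N => // k _; exact: ac.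
Qed.

(** Picard iteration converges on the whole line at once when distances are
    measured with the weight [exp (2 K |t|)]. *)
Theorem picard (R : realType) (m : nat) (F : 'rV[R]_m -> 'rV[R]_m) (M K : R)
    (y : 'rV[R]_m) : 0 < K ->
  (forall x, `|F x| <= M) -> (forall a b, `|F a - F b| <= K * `|a - b|) ->
  exists z : R -> 'rV[R]_m, z 0 = y /\ solves F z.
Proof.
move=> K0 FM FK.
have M0 : 0 <= M by exact: le_trans (FM 0).
have cF : continuous F by apply: (@lipschitz_cont _ _ _ _ K) => a b; exact: FK.
have /choice[S SP] (w : R -> 'rV[R]_m) : exists z : R -> 'rV[R]_m,
    continuous w -> z 0 = y /\
    forall (t : R) i, is_derive t 1 (fun s : R => z s 0 i) (F (w t) 0 i).
  have [cw|ncw] := pselect (continuous w); last by exists w.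
  have [|z zP] := @integral_curve R m (F \o w) y; last by exists z => _.
  by move=> t; apply: continuous_comp; [exact: cw|exact: cF].
have Slip w : continuous w -> forall s t, `|S w t - S w s| <= M * `|t - s|.
  move=> cw; apply: (@vec_lipschitz _ _ _ (F \o w)); first exact: (SP _ cw).2.
  by move=> t; exact: FM.
pose Z k := iter k S (cst y).
have cZ k : continuous (Z k).
  elim: k => [|k IH]; first by move=> t; exact: cvg_cst.
  exact: lipschitz_cont (Slip _ IH).
have Z0 k : Z k 0 = y by case: k => [|k] //; exact: (SP _ (cZ k)).1.
have Zd k := (SP _ (cZ k)).2.
pose c := M / K; pose E (t : R) := expR (2 * K * t).
have c0 : 0 <= c by rewrite divr_ge0// ltW.
(* Integrating [K d exp (2 K s)] from 0 to [|t|] costs the factor [1 / 2]. *)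
have contract (a b : R -> 'rV[R]_m) (d : R) : continuous a -> continuous b ->
    (forall t, `|a t - b t| <= d * E `|t|) ->
    forall t, `|S a t - S b t| <= d / 2 * E `|t|.
  move=> ca cb ab; have [Sa0 Sad] := SP _ ca; have [Sb0 Sbd] := SP _ cb.
  have d0 : 0 <= d.
    by have := le_trans (normr_ge0 _) (ab 0); rewrite /E pmulr_lge0// expR_gt0.
  apply: (vec_comparison (is_deriveB_coord Sad Sbd) (fun t _ => is_derive_expZ (d / 2) (2 * K) t)).
    by rewrite Sa0 Sb0 subrr normr0 mulr_ge0 ?expR_ge0// divr_ge0.
  move=> t; rewrite (le_trans (FK _ _))// (_ : d / 2 * (2 * K) = K * d); last by field.
  by rewrite -mulrA ler_pM2l// ab.
have ZE k : forall t, `|Z k.+1 t - Z k t| <= c * 2^-1 ^+ k * E `|t|.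
  elim: k => [|k IH] t; last first.
    rewrite exprSr mulrA; exact: (contract (Z k.+1) (Z k) _ (cZ _) (cZ _) IH).
  rewrite expr0 mulr1; move: t.
  have d0 (t : R) i : is_derive t 1 (fun s : R => Z 0 s 0 i) ((cst 0 : R -> 'rV[R]_m) t 0 i).
    by rewrite mxE; exact: is_derive_cst.
  apply: (vec_comparison (is_deriveB_coord (Zd 0) d0) (fun t _ => is_derive_expZ c (2 * K) t)).
    by rewrite (Z0 1 : S (Z 0) 0 = y) (Z0 0) subrr normr0 mulr_ge0 ?expR_ge0.
  move=> t; rewrite subr0 (le_trans (FM _))// (_ : c * (2 * K) = M * 2); last first.
    by rewrite /c; field; rewrite gt_eqF.
  rewrite -mulrA ler_peMr// (le_trans (_ : 1 <= 2))// ?ler1n// ler_peMr//.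
  by rewrite (le_trans _ (expR_ge1Dx _))// lerDl !mulr_ge0// ltW.
have /choice[z zP] (t : R) : exists l, forall k, `|l - Z k t| <= 2 * (c * E `|t|) * 2^-1 ^+ k.
  by apply: cauchy_geometric => k; rewrite mulrAC; exact: ZE.
(* All iterates are [M]-Lipschitz in time, hence so is their limit. *)
have cz : continuous z.
  apply: (@lipschitz_cont _ _ _ _ M) => s t; rewrite -subr_le0.
  apply: (@geometric_le0 _ _ (c * E `|t| + c * E `|s|)) => k.
  rewrite lerBlDl -[z t](subrK (Z k.+1 t)) -addrA.
  have h : `|Z k.+1 t - z s| <= M * `|t - s| + 2 * (c * E `|s|) * 2^-1 ^+ k.+1.
    rewrite -[Z k.+1 t](subrK (Z k.+1 s)) -addrA (le_trans (ler_normD _ _))//.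
    by apply: lerD (Slip _ (cZ k) s t) _; rewrite distrC; exact: zP.
  rewrite (le_trans (ler_normD _ _))// (le_trans (lerD (zP t k.+1) h))// exprS.
  by rewrite le_eqVlt; apply/orP; left; apply/eqP; field.
exists z; split.
  apply/eqP; rewrite -subr_eq0 -normr_le0; apply: (@geometric_le0 _ _ (2 * (c * E `|0 : R|))) => k.
  by have := zP 0 k; rewrite Z0.
have [_ Szd] := SP _ cz.
suff zS : S z = z by move=> t i; have := Szd t i; rewrite zS.
symmetry.
apply/funext => t; apply/eqP; rewrite -subr_eq0 -normr_le0.
apply: (@geometric_le0 _ _ (2 * (c * E `|t|))) => k.
have h : `|Z k.+1 t - S z t| <= 2 * c * 2^-1 ^+ k / 2 * E `|t|.
  apply: contract => // s; rewrite distrC (le_trans (zP s k))//.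
  by rewrite le_eqVlt; apply/orP; left; apply/eqP; ring.
rewrite -[z t](subrK (Z k.+1 t)) -addrA (le_trans (ler_normD _ _))//.
rewrite (le_trans (lerD (zP t k.+1) h))// exprS.
by rewrite le_eqVlt; apply/orP; left; apply/eqP; field.
Qed.

(** Bounds of the form [(u0 + e) exp (2 K |t|)] on the distance improve to
    [(u0 + (u0 + e) / 2) exp (2 K |t|)] by one integration of the Lipschitz
    estimate; their fixed point is [2 u0].  The bound [M] on the field supplies
    the first of them. *)
Lemma gronwall (R : realType) (m : nat) (F : 'rV[R]_m -> 'rV[R]_m) (M K : R)
    (z w : R -> 'rV[R]_m) : 0 < K ->
  (forall x, `|F x| <= M) -> (forall a b, `|F a - F b| <= K * `|a - b|) ->
  solves F z -> solves F w ->
  forall t, `|z t - w t| <= 2 * `|z 0 - w 0| * expR (2 * K * `|t|).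
Proof.
move=> K0 FM FK zF wF t.
have M0 : 0 <= M by exact: le_trans (FM 0).
pose E (t : R) := expR (2 * K * t).
pose u0 := `|z 0 - w 0|.
have u0_ge0 : 0 <= u0 by exact: normr_ge0.
have ud := is_deriveB_coord zF wF.
pose d := M / K.
have d0 : 0 <= d by rewrite divr_ge0// ltW.
have Ege1 (s : R) : 0 <= s -> 1 <= E s.
  by move=> s0; rewrite (le_trans _ (expR_ge1Dx _))// lerDl !mulr_ge0// ltW.
have bound k : forall s, `|z s - w s| <= (2 * u0 + d * 2^-1 ^+ k) * E `|s|.
  have step (e : R) : 0 <= e -> (forall s, `|F (z s) - F (w s)| <= e * (2 * K) * E `|s|) ->
      forall s, `|z s - w s| <= (u0 + e) * E `|s|.
    move=> e0 Fe s.
    have gd (r : R) : 0 <= r -> is_derive r 1 (cst u0 + (fun r : R => e * E r)) (e * (2 * K) * E r).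
      move=> _; have := is_deriveD (is_derive_cst u0 r 1) (is_derive_expZ e (2 * K) r).
      by rewrite add0r.
    have u00 : `|z 0 - w 0| <= (cst u0 + (fun r : R => e * E r)) 0.
      by rewrite /GRing.add/= lerDl mulr_ge0// expR_ge0.
    apply: le_trans (vec_comparison ud gd u00 Fe s) _.
    by rewrite mulrDl lerD2r ler_peMr ?Ege1.
  elim: k => [|k IH].
    (* The field is bounded by [M] and [2 K d = 2 M]. *)
    have h (s : R) : `|F (z s) - F (w s)| <= d * (2 * K) * E `|s|.
      have -> : d * (2 * K) = M + M by rewrite /d; field; rewrite gt_eqF.
      rewrite (le_trans (ler_normB _ _))// (le_trans (lerD (FM _) (FM _)))//.
      by rewrite ler_peMr ?Ege1// addr_ge0.
    move=> s; apply: le_trans (step d d0 h s) _.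
    by rewrite expr0 mulr1 ler_wpM2r ?expR_ge0// lerD2r mulr_natl mulr2n lerDl.
  move=> s; rewrite exprS.
  have -> : 2 * u0 + d * (2^-1 * 2^-1 ^+ k) = u0 + (2 * u0 + d * 2^-1 ^+ k) / 2 by field.
  apply: step => [|r]; first by rewrite divr_ge0// addr_ge0// mulr_ge0// exprn_ge0.
  rewrite (le_trans (FK _ _))//.
  have -> : (2 * u0 + d * 2^-1 ^+ k) / 2 * (2 * K) = K * (2 * u0 + d * 2^-1 ^+ k) by field.
  by rewrite -mulrA ler_pM2l.
rewrite -subr_le0; apply: (@geometric_le0 _ _ (d * E `|t|)) => k.
by rewrite lerBlDr (le_trans (bound k t))// mulrDl addrC mulrAC.
Qed.

(** ** The flow on the phase space *)

Definition phase_solves (R : realType) (n : nat)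
    (X : 'rV[R]_n * 'rV[R]_n -> 'rV[R]_n * 'rV[R]_n)
    (z : R -> 'rV[R]_n * 'rV[R]_n) : Prop :=
  forall (t : R) i, is_derive t 1 (fun s : R => (z s).1 0 i) ((X (z t)).1 0 i) /\
    is_derive t 1 (fun s : R => (z s).2 0 i) ((X (z t)).2 0 i).

(** The phase space is a product of row spaces; concatenation identifies it
    isometrically with one row space, where the results above apply. *)
Definition pack (R : realType) (n : nat) (z : 'rV[R]_n * 'rV[R]_n) :
  'rV[R]_(n + n) := row_mx z.1 z.2.
Definition unpack (R : realType) (n : nat) (x : 'rV[R]_(n + n)) :
  'rV[R]_n * 'rV[R]_n := (lsubmx x, rsubmx x).

Lemma packK (R : realType) (n : nat) : cancel (@pack R n) (@unpack R n).
Proof. by case=> a b; rewrite /pack /unpack /= row_mxKl row_mxKr. Qed.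

Lemma unpackK (R : realType) (n : nat) : cancel (@unpack R n) (@pack R n).
Proof. by move=> x; rewrite /pack /unpack /= hsubmxK. Qed.

Lemma packB (R : realType) (n : nat) (a b : 'rV[R]_n * 'rV[R]_n) :
  pack (a - b) = pack a - pack b.
Proof. by rewrite /pack opp_row_mx add_row_mx. Qed.

Lemma prod_norm_le (R : realType) (n : nat) (z : 'rV[R]_n * 'rV[R]_n) (a : R) :
  (`|z| <= a) = (`|z.1| <= a) && (`|z.2| <= a).
Proof. by rewrite prod_normE ge_max. Qed.

Lemma norm_pack (R : realType) (n : nat) (z : 'rV[R]_n * 'rV[R]_n) :
  `|pack z| = `|z|.
Proof.
apply/eqP; rewrite eq_le; apply/andP; split.
  have /andP[z1 z2] : (`|z.1| <= `|z|) && (`|z.2| <= `|z|) by rewrite -prod_norm_le.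
  apply: rv_norm_le => // i; rewrite /pack mxE; case: splitP => j _.
    exact: le_trans (coord_norm_le _ _) z1.
  exact: le_trans (coord_norm_le _ _) z2.
rewrite prod_norm_le; apply/andP; split; apply: rv_norm_le => // i.
  by have := coord_norm_le (pack z) (lshift n i); rewrite /pack row_mxEl.
by have := coord_norm_le (pack z) (rshift n i); rewrite /pack row_mxEr.
Qed.

Section Flow.
Variables (R : realType) (n : nat).
Local Notation V2 := ('rV[R]_n * 'rV[R]_n)%type.
Variables (X : V2 -> V2) (M K : R).
Hypotheses (K0 : 0 < K) (XM : forall x, `|X x| <= M)
  (XK : forall a b, `|X a - X b| <= K * `|a - b|).

Let F (x : 'rV[R]_(n + n)) := pack (X (unpack x)).

Let FM x : `|F x| <= M. Proof. by rewrite norm_pack. Qed.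
Let FK a b : `|F a - F b| <= K * `|a - b|.
Proof.
rewrite /F -packB norm_pack (le_trans (XK _ _))// ler_pM2l// -norm_pack packB.
by rewrite !unpackK.
Qed.

Lemma phase_solvesP z : phase_solves X z <-> solves F (@pack R n \o z).
Proof.
split=> [zX t i|zF t i].
  rewrite -(splitK i); case: (fintype.split i) => j /=; rewrite /F /= packK.
    have [h _] := zX t j; rewrite /pack row_mxEl.
    have -> // : (fun s : R => row_mx (z s).1 (z s).2 0 (lshift n j)) =
                 (fun s : R => (z s).1 0 j).
    by apply/funext => s; rewrite row_mxEl.
  have [_ h] := zX t j; rewrite /pack row_mxEr.
  have -> // : (fun s : R => row_mx (z s).1 (z s).2 0 (rshift n j)) =
               (fun s : R => (z s).2 0 j).
  by apply/funext => s; rewrite row_mxEr.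
split.
  have := zF t (lshift n i); rewrite /F /= packK /pack row_mxEl.
  have -> // : (fun s : R => row_mx (z s).1 (z s).2 0 (lshift n i)) =
               (fun s : R => (z s).1 0 i).
  by apply/funext => s; rewrite row_mxEl.
have := zF t (rshift n i); rewrite /F /= packK /pack row_mxEr.
have -> // : (fun s : R => row_mx (z s).1 (z s).2 0 (rshift n i)) =
             (fun s : R => (z s).2 0 i).
by apply/funext => s; rewrite row_mxEr.
Qed.

Lemma flow_exists y : exists z, z 0 = y /\ phase_solves X z.
Proof.
have [x [x0 xF]] := picard (pack y) K0 FM FK.
exists (@unpack R n \o x); split; first by rewrite /= x0 packK.
apply/phase_solvesP; have -> // : @pack R n \o (@unpack R n \o x) = x.
by apply/funext => t /=; rewrite unpackK.
Qed.

Lemma flow_dependence z w : phase_solves X z -> phase_solves X w ->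
  forall t, `|z t - w t| <= 2 * `|z 0 - w 0| * expR (2 * K * `|t|).
Proof.
move=> /phase_solvesP zF /phase_solvesP wF t.
by have := gronwall K0 FM FK zF wF t; rewrite /= -!packB !norm_pack.
Qed.

Lemma flow_lipschitz z : phase_solves X z ->
  forall s t, `|z t - z s| <= M * `|t - s|.
Proof.
move=> /phase_solvesP zF s t.
have := vec_lipschitz zF (fun t => FM _) s t.
by rewrite /= -packB norm_pack.
Qed.

Lemma flow_continuous z : phase_solves X z -> continuous z.
Proof.
move=> zX; apply: (@lipschitz_cont _ _ _ _ M) => s t.
exact: flow_lipschitz.
Qed.

End Flow.

(** * Backward asymptotic orbits of a field with a Lyapunov function *)

(** [L] increases along the orbits in the compact set [A] at the rate [W], which
    is positive away from the equilibrium 0.  Orbits in [A] with [L > 0] can leave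
    [A] only through [|x.1| = r], and there are such orbits starting arbitrarily
    close to 0. *)
Section AsymptoticOrbit.
Variables (R : realType) (n : nat).
Local Notation V2 := ('rV[R]_n * 'rV[R]_n)%type.
Variables (X : V2 -> V2) (M K : R).
Hypotheses (K0 : 0 < K) (XM : forall x, `|X x| <= M)
  (XK : forall a b, `|X a - X b| <= K * `|a - b|) (X0 : X 0 = 0).
Variables (A : set V2) (r : R) (L W : V2 -> R).
Hypotheses (r0 : 0 < r) (cA : compact A) (cL : continuous L) (cW : continuous W)
  (L0 : L 0 = 0)
  (LW : forall z, phase_solves X z -> forall t : R, is_derive t 1 (L \o z) (W (z t)))
  (W_ge0 : forall x, A x -> 0 <= W x)
  (W_gt0 : forall x, A x -> x != 0 -> 0 < W x)
  (A_r : forall x, A x -> `|x.1| <= r)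
  (A_continues : forall z (t : R), phase_solves X z -> A (z t) -> `|(z t).1| < r ->
    0 < L (z t) -> exists2 d : R, 0 < d & forall s, t <= s <= t + d -> A (z s))
  (A_small : forall e : R, 0 < e -> exists x, [/\ A x, `|x| < e & 0 < L x]).

Let closedA : closed A.
Proof. by apply: compact_closed => //; exact: norm_hausdorff. Qed.

Lemma rate_bound (rho : R) : 0 < rho ->
  exists2 m : R, 0 < m & forall x, A x -> rho <= `|x| -> m <= W x.
Proof.
move=> rho0; pose B := A `&` [set x | rho <= `|x|].
have [B0|B0] := pselect (B !=set0); last first.
  by exists 1 => // x Ax rx; exfalso; apply: B0; exists x.
have cB : compact B.
  apply: compact_closedI => //.
  apply: (@closed_comp _ _ (fun x : V2 => `|x|) [set y | rho <= y]).
    by move=> x _; exact: norm_continuous.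
  exact: closed_ge.
have [c] := @compact_EVT_min _ R W B B0 cB (continuous_subspaceT cW).
rewrite inE => -[Ac rc] cmin; exists (W c).
  by apply: W_gt0 => //; rewrite -normr_gt0 (lt_le_trans rho0).
by move=> x Ax rx; apply: cmin; rewrite inE.
Qed.

Lemma lyapunov_bounded : exists C : R, forall x, A x -> `|L x| <= C.
Proof.
have [A0|A0] := pselect (A !=set0); last first.
  by exists 0 => x Ax; exfalso; apply: A0; exists x.
have cnL : continuous (fun x => `|L x|).
  by move=> x; apply: continuous_comp; [exact: cL|exact: norm_continuous].
have [c _ cmax] := @compact_EVT_max _ R _ A A0 cA (continuous_subspaceT cnL).
by exists `|L c| => x Ax; apply: cmax; rewrite inE.
Qed.

Lemma lyapunov_growth z (a b m : R) : phase_solves X z -> a <= b ->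
  (forall s, a <= s <= b -> m <= W (z s)) -> L (z a) + m * (b - a) <= L (z b).
Proof.
move=> zX ab mW.
have [c cab e] := @mean_value R (L \o z) (W \o z) a b ab (fun t _ => LW zX t).
by rewrite -lerBrDl; move: e => /= ->; rewrite ler_wpM2r ?subr_ge0// mW.
Qed.

(** As [L] does not decrease, the orbit keeps a distance [rho] from the origin, so
    [L] grows at some rate [m > 0]; but [L] is bounded on [A].  The exit time is
    the supremum of the times up to which the orbit is in [A]. *)
Lemma orbit_exits z : phase_solves X z -> A (z 0) -> 0 < L (z 0) ->
  exists tau : R, [/\ 0 <= tau, `|(z tau).1| = r &
    forall s, 0 <= s <= tau -> A (z s)].
Proof.
move=> zX Az0 Lz0.
pose E : set R := [set t | 0 <= t /\ forall s, 0 <= s <= t -> A (z s)].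
have E0 : E 0.
  by split => // s /andP[s0 s1]; have -> : s = 0 by apply/eqP; rewrite eq_le s0 s1.
have [rho rho0 rhoP] : exists2 rho : R, 0 < rho &
    forall x, L (z 0) <= L x -> rho <= `|x|.
  have /cvgrPdist_lt/(_ _ Lz0) := @cL 0.
  rewrite L0 => /nbhs_normP[rho rho0 rhoP]; exists rho => // x Lx.
  rewrite leNgt; apply/negP => xr.
  have := rhoP x; rewrite /= !sub0r !normrN => /(_ xr).
  by rewrite ltNge (le_trans Lx)// ler_norm.
have [m m0 mW] := rate_bound rho0.
have EL t : E t -> L (z 0) <= L (z t).
  move=> [t0 tA]; have := @lyapunov_growth z 0 t 0 zX t0.
  by rewrite mul0r addr0; apply=> s st; apply: W_ge0; exact: tA.
have ELm t : E t -> L (z 0) + m * t <= L (z t).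
  move=> Et; have [t0 tA] := Et; rewrite -[X in m * X]subr0.
  apply: lyapunov_growth => // s /andP[s0 st]; apply: mW.
    by apply: tA; rewrite s0.
  apply: rhoP; apply: EL; split => // u /andP[u0 us]; apply: tA.
  by rewrite u0 (le_trans us).
have [C CP] := lyapunov_bounded.
have Eub t : E t -> t <= C / m.
  move=> Et; rewrite ler_pdivlMr// mulrC.
  have [t0 tA] := Et.
  have h : A (z t) by apply: tA; rewrite t0 lexx.
  apply: le_trans (CP _ h); apply: le_trans (ler_norm _).
  by apply: le_trans (ELm _ Et); rewrite lerDr ltW.
have supE : has_sup E by split; [exists 0|exists (C / m)].
have tau0 : 0 <= sup E by exact: sup_upper_bound.
have lt_tau s : 0 <= s < sup E -> A (z s).
  move=> /andP[s0 st]; have d0 : 0 < sup E - s by rewrite subr_gt0.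
  have [t [t0 tA]] := sup_adherent d0 supE.
  by rewrite opprB addrC subrK => /ltW st'; apply: tA; rewrite s0.
have Atau : A (z (sup E)).
  have [->//|tau_n0] := eqVneq (sup E) 0.
  have {tau_n0} tau_gt0 : 0 < sup E by rewrite lt0r tau_n0.
  apply: closedA => B /(flow_continuous XM zX) /nbhs_normP[d d0 dB].
  pose s := Num.max 0 (sup E - d / 2).
  have ss : 0 <= s < sup E.
    rewrite le_max lexx/= gt_max tau_gt0/= ltrBlDr ltrDl divr_gt0//.
  exists (z s); split; first exact: lt_tau.
  apply: dB => /=; have [s0 s1] := andP ss.
  rewrite ger0_norm ?subr_ge0 ?ltW// ltrBlDr -ltrBlDl lt_max; apply/orP; right.
  by rewrite ltrD2l ltrN2 ltr_pdivrMr// ltr_pMr// ltr1n.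
have Etau : E (sup E).
  split => // s /andP[s0]; rewrite le_eqVlt => /predU1P[->//|st].
  by apply: lt_tau; rewrite s0.
exists (sup E); split => //; last exact: Etau.2.
apply/eqP; rewrite eq_le A_r//= leNgt; apply/negP => lt_r.
have [d d0 dA] := A_continues zX Atau lt_r (lt_le_trans Lz0 (EL _ Etau)).
suff : E (sup E + d).
  by move=> /(sup_upper_bound supE); rewrite leNgt ltrDl d0.
split; first by rewrite addr_ge0// ltW.
move=> s /andP[s0 sd]; have [st|st] := ltP s (sup E).
  by apply: lt_tau; rewrite s0.
by apply: dA; rewrite st.
Qed.

Lemma phase_solves_shift z (c : R) : phase_solves X z -> phase_solves X (fun t => z (t + c)).
Proof.
move=> zX t i; have [h1 h2] := zX (t + c) i.
have sh := is_derive_shift t (1 : R) c.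
split.
  by have := @is_derive1_comp _ _ (shift c) t _ _ h1 sh; rewrite mulr1.
by have := @is_derive1_comp _ _ (shift c) t _ _ h2 sh; rewrite mulr1.
Qed.

(** By comparison with the constant solution 0, an orbit that starts very close
    to 0 needs more than the time [N] to reach [|x.1| = r]; time is then counted
    from the exit. *)
Lemma long_orbit (N : R) : exists w : R -> V2,
  [/\ phase_solves X w, `|(w 0).1| = r & forall t, - N <= t <= 0 -> A (w t)].
Proof.
(* Up to time [N] distances grow by the factor [2 exp (2 K |N|)] at most. *)
pose e := r / (2 * expR (2 * K * `|N|)).
have e0 : 0 < e by rewrite divr_gt0// mulr_gt0// expR_gt0.
have [x [Ax xe Lx]] := A_small e0.
have [z [z0 zX]] := flow_exists K0 XM XK x.
rewrite -z0 in Ax xe Lx.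
have [tau [tau0 tau_r tauA]] := orbit_exits zX Ax Lx.
have cst0 : phase_solves X (cst 0).
  by move=> t i; rewrite /= X0 !mxE; split; exact: is_derive_cst.
have tauN : N <= tau.
  rewrite leNgt; apply/negP => lt_tauN.
  have := flow_dependence K0 XM XK zX cst0 tau; rewrite /= !subr0 leNgt => /negP; apply.
  apply: (@lt_le_trans _ _ r).
    apply: (@le_lt_trans _ _ (2 * `|z 0| * expR (2 * K * `|N|))).
      rewrite ler_wpM2l ?mulr_ge0// ler_expR ler_pM2l ?mulr_gt0//.
      by rewrite !ger0_norm// ?ltW// (le_lt_trans tau0).
    by rewrite mulrAC mulrC -ltr_pdivlMr ?mulr_gt0 ?expR_gt0.
  rewrite -tau_r.
  have := lexx `|z tau|; rewrite [in X in X -> _]prod_norm_le; by case/andP.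
exists (fun t => z (t + tau)); split.
- exact: phase_solves_shift.
- by rewrite add0r.
- move=> t /andP[Nt t0]; apply: tauA; rewrite gerDr t0 andbT.
  by rewrite -lerBlDr sub0r (le_trans _ Nt)// lerN2.
Qed.

(** The exit points of ever longer orbits have a cluster point [y0] in the compact
    set [A].  On a fixed stretch of the past the orbit through [y0] is a limit of
    orbits in [A], hence is in [A]. *)
Lemma entire_orbit : exists w : R -> V2,
  [/\ phase_solves X w, r <= `|(w 0).1| & forall t, t <= 0 -> A (w t)].
Proof.
have /choice[w wP] (N : nat) := long_orbit N%:R.
pose y N := w N 0.
have yA N : A (y N) by have [_ _] := wP N; apply; rewrite lexx oppr_le0 ler0n.
have [y0 [Ay0 y0P]] : A `&` cluster (y @ \oo) !=set0.
  by apply: cA; exists 0%N => // N _; exact: yA.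
have near_y0 (N : nat) (e : R) : 0 < e ->
    exists k : nat, (N <= k)%N /\ `|y k - y0| < e.
  move=> e0.
  have [||x [[k Nk <-] ye]] := y0P (y @` [set k | (N <= k)%N]) [set x | `|x - y0| < e].
  - by exists N => // k Nk; exists k.
  - have := @cvgr_distC_lt _ _ _ _ _ id y0 cvg_id _ e0; exact.
  - by exists k.
have [z [z0 zX]] := flow_exists K0 XM XK y0.
exists z; split => //.
  apply/ler_addgt0Pr => e e0; have [k [_ ke]] := near_y0 0%N e e0.
  have [_ <- _] := wP k; rewrite z0 -lerBlDl.
  rewrite (le_trans (lerB_dist _ _))//; apply: le_trans (ltW ke).
  by have := lexx `|y k - y0|; rewrite [in X in X -> _]prod_norm_le => /andP[].
move=> t t0; apply: closedA => B /nbhs_normP[d d0 dB].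
pose e := d / (2 * expR (2 * K * `|t|)).
have e0 : 0 < e by rewrite divr_gt0// mulr_gt0// expR_gt0.
have [k [tk ke]] := near_y0 (Num.bound t) e e0.
have [wX _ wA] := wP k.
exists (w k t); split.
  apply: wA; rewrite t0 andbT lerNl.
  have := archi_boundP (normr_ge0 t); rewrite ler0_norm// => h.
  rewrite (le_trans (ltW h))// ler_nat (leq_trans _ tk)//.
  by rewrite /Num.bound/= normrN.
apply: dB => /=; rewrite distrC.
apply: le_lt_trans (flow_dependence K0 XM XK wX zX t) _.
by rewrite z0 mulrAC mulrC -ltr_pdivlMr ?mulr_gt0 ?expR_gt0.
Unshelve. all: by end_near. Qed.

(** If the orbit were at distance [rho] from the origin at a time [t] far in the
    past, it would stay at distance [rho / 2] for the time [rho / (2 (M + 1))]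
    because its speed is at most [M].  Meanwhile [L] would grow by more than what
    is left between its infimum and its value at a suitable time [T]. *)
Theorem backward_asymptotic : exists z : R -> V2,
  [/\ phase_solves X z, z 0 != 0, forall t, t <= 0 -> A (z t) &
      z t @[t --> -oo] --> (0 : V2)].
Proof.
have [z [zX rz zA]] := entire_orbit; exists z; split => //.
  apply/eqP => z00; move: rz; rewrite z00 normr0 => rz.
  by move: r0; rewrite ltNge rz.
have [C CP] := lyapunov_bounded.
pose E := [set L (z t) | t in [set t | t <= 0]].
have infE : has_inf E.
  split; first by exists (L (z 0)); exists 0 => /=.
  exists (- C) => _ [t t0 <-].
  by have := CP _ (zA _ t0); rewrite ler_norml => /andP[].
apply/cvgrPdist_lt => /= rho rho0.
have [m m0 mW] := rate_bound (divr_gt0 rho0 (ltr0Sn _ 1)).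
have M1 : 0 < M + 1 by rewrite (le_lt_trans (le_trans (normr_ge0 _) (XM 0)))// ltrDl.
pose d := rho / (2 * (M + 1)).
have d0 : 0 < d by rewrite divr_gt0// mulr_gt0.
have [_ [T T0 <-] LT] := inf_adherent (mulr_gt0 m0 d0) infE.
near=> t.
have tT : t <= T - d by near: t; apply: nbhs_ninfty_le; rewrite num_real.
have t0 : t <= 0 by rewrite (le_trans tT)// lerBlDr add0r (le_trans T0)// ltW.
rewrite sub0r normrN ltNge; apply/negP => rho_t.
have tdT : t + d <= T by rewrite -lerBrDr.
have h1 : L (z t) + m * d <= L (z (t + d)).
  have -> : m * d = m * (t + d - t) by rewrite addrAC subrr add0r.
  apply: lyapunov_growth => //.
    by rewrite lerDl ltW.
  move=> s /andP[ts sd]; apply: mW.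
    by apply: zA; rewrite (le_trans sd)// (le_trans tdT).
  have := flow_lipschitz XM zX s t.
  rewrite ler0_norm ?subr_le0// opprB => h.
  have h2 : `|z t| <= `|z s| + M * (s - t).
    by rewrite -[z t](subrK (z s)) addrC (le_trans (ler_normD _ _))// lerD2l.
  have h3 : M * (s - t) <= rho / 2.
    apply: (@le_trans _ _ ((M + 1) * d)).
      apply: ler_pM; rewrite ?subr_ge0//.
      - exact: le_trans (normr_ge0 _) (XM 0).
      - by rewrite lerDl.
      - by rewrite lerBlDl.
    by rewrite /d le_eqVlt; apply/orP; left; apply/eqP; field; rewrite gt_eqF.
  by move: rho_t h2 h3; lra.
have h2 : L (z (t + d)) <= L (z T).
  have := @lyapunov_growth z (t + d) T 0 zX tdT.
  rewrite mul0r addr0; apply => s /andP[_ sT].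
  by apply: W_ge0; apply: zA; rewrite (le_trans sT).
have h3 : inf E <= L (z t) by apply: ge_inf => //; [exact: infE.2|exists t].
by move: h1 h2 h3 LT; lra.
Unshelve. all: by end_near. Qed.

End AsymptoticOrbit.

(** * Differential calculus in finite dimension *)

Lemma is_derive_chain (R : realType) (V : normedModType R) (f : V -> R)
    (c : R -> V) (t : R) (v : V) :
  is_derive t 1 c v -> differentiable f (c t) ->
  is_derive t 1 (f \o c) ('D_v f (c t)).
Proof.
move=> cv df.
have dc : differentiable c t by apply/derivable1_diffP.
have dfc : differentiable (f \o c) t by exact: differentiable_comp.
apply: DeriveDef; first exact/derivable1_diffP.
rewrite !deriveE//= diff_comp//=.
by congr ('d f (c t) _); have := @derive_val _ _ _ _ _ _ _ cv; rewrite deriveE.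
Qed.

Lemma is_derive_rV (R : realType) (m : nat) (q : R -> 'rV[R]_m) (t : R)
    (v : 'rV[R]_m) :
  (forall i, is_derive t 1 (fun s : R => q s 0 i) (v 0 i)) -> is_derive t 1 q v.
Proof.
move=> qv.
have dq : derivable q t 1.
  by apply/derivable_mxP => i j; rewrite ord1; exact: ex_derive.
apply: DeriveDef => //; rewrite derive_mx//.
by apply/rowP => i; rewrite mxE derive_val.
Qed.

Lemma is_derive_pair (R : realType) (V W : normedModType R) (q : R -> V)
    (p : R -> W) (t : R) (v : V) (w : W) :
  is_derive t 1 q v -> is_derive t 1 p w ->
  is_derive t 1 (fun s : R => (q s, p s)) (v, w).
Proof.
move=> qv pw.
have dq : differentiable q t by apply/derivable1_diffP.
have dp : differentiable p t by apply/derivable1_diffP.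
have dqp : differentiable (fun s : R => (q s, p s)) t by exact: differentiable_pair.
apply: DeriveDef; first exact/derivable1_diffP.
rewrite deriveE// diff_pair//=.
have := @derive_val _ _ _ _ _ _ _ qv; rewrite deriveE// => ->.
by have := @derive_val _ _ _ _ _ _ _ pw; rewrite deriveE// => ->.
Qed.

Lemma derive_lin_sum (R : realType) (V : normedModType R) (f : V -> R) (x : V)
    (I : finType) (c : I -> R) (e : I -> V) : differentiable f x ->
  'D_(\sum_i c i *: e i) f x = \sum_i c i * 'D_(e i) f x.
Proof.
move=> df; rewrite deriveE// linear_sum/=; apply: eq_bigr => i _.
by rewrite linearZ/= deriveE.
Qed.

Lemma compact_bounded_cont (R : realType) (V : topologicalType) (S : set V)
    (f : V -> R) : compact S -> (forall x, S x -> {for x, continuous f}) ->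
  exists2 C : R, 0 <= C & forall x, S x -> `|f x| <= C.
Proof.
move=> cS cf.
have [S0|S0] := pselect (S !=set0); last first.
  by exists 0 => // x Sx; exfalso; apply: S0; exists x.
have cnf : {within S, continuous (fun x => `|f x|)}.
  apply: continuous_in_subspaceT => x; rewrite inE => Sx.
  by apply: continuous_comp; [exact: cf|exact: norm_continuous].
have [c _ cmax] := @compact_EVT_max _ R _ S S0 cS cnf.
by exists `|f c| => // x Sx; apply: cmax; rewrite inE.
Qed.

Lemma is_derive_line (R : realType) (V : normedModType R) (x v : V) (t : R) :
  is_derive t 1 (fun s : R => x + s *: v) v.
Proof.
have -> : (fun s : R => x + s *: v) = cst x + ( *:%R^~ v) by [].
have h : is_derive t 1 ( *:%R^~ v : R -> V) v.
  have hd : is_diff t ( *:%R^~ v : R -> V) ( *:%R^~ v) by exact: is_diff_scalel.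
  apply: DeriveDef; first by apply/derivable1_diffP.
  by rewrite deriveE// diff_val scale1r.
by have := is_deriveD (is_derive_cst x t 1) h; rewrite add0r.
Qed.

(** The coordinates [c] in a basis [e] are kept abstract so that the lemma serves
    both for the configuration space and for the phase space.  The mean value
    theorem on the segment from [x] to [y] reduces it to bounds for the
    derivatives along the [e i] on the compact convex set [S]. *)
Lemma C1_lipschitz (R : realType) (V : normedModType R) (I : finType)
    (e : I -> V) (c : I -> V -> R) (U S : set V) (f : V -> R) :
  (forall v, v = \sum_i c i v *: e i) -> (forall i v, `|c i v| <= `|v|) ->
  (forall x, U x -> differentiable f x) ->
  (forall v x, U x -> {for x, continuous ('D_v f)}) ->
  S `<=` U -> compact S ->
  (forall x y (t : R), S x -> S y -> 0 <= t <= 1 -> S (x + t *: (y - x))) ->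
  exists2 K : R, 0 <= K & forall x y, S x -> S y -> `|f y - f x| <= K * `|y - x|.
Proof.
move=> cE c1 df cdf SU cS convS.
have /choice[C CP] (i : I) : exists C : R, 0 <= C /\
    forall x, S x -> `|'D_(e i) f x| <= C.
  have [|C C0 CP] := @compact_bounded_cont R V S ('D_(e i) f) cS; last by exists C.
  by move=> x /SU; exact: cdf.
exists (\sum_i C i); first by apply: sumr_ge0 => i _; exact: (CP i).1.
move=> x y Sx Sy.
pose g (t : R) := f (x + t *: (y - x)).
have gd (t : R) : 0 <= t <= 1 ->
    is_derive t 1 g ('D_(y - x) f (x + t *: (y - x))).
  move=> t01; apply: is_derive_chain; first exact: is_derive_line.
  by apply: df; apply: SU; exact: convS.
have [s s01] := @mean_value R g (fun t => 'D_(y - x) f (x + t *: (y - x))) 0 1 ler01 gd.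
rewrite /g scale1r scale0r addr0 subr0 mulr1 [x + (y - x)]addrC subrK => ->.
have Ss : S (x + s *: (y - x)) by exact: convS.
have -> : 'D_(y - x) f (x + s *: (y - x)) =
    \sum_i c i (y - x) * 'D_(e i) f (x + s *: (y - x)).
  by rewrite -derive_lin_sum -?cE//; apply: df; exact: SU.
rewrite (le_trans (ler_norm_sum _ _ _))// mulr_suml ler_sum// => i _.
by rewrite normrM mulrC ler_pM//; exact: (CP i).2.
Qed.

Lemma row_coords (R : realType) (n : nat) (v : 'rV[R]_n) :
  v = \sum_i v 0 i *: delta_mx 0 i.
Proof. exact: row_sum_delta. Qed.

Definition phase_basis (R : realType) (n : nat) (i : 'I_n + 'I_n) : 'rV[R]_n * 'rV[R]_n :=
  match i with inl j => (delta_mx 0 j, 0) | inr j => (0, delta_mx 0 j) end.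

Definition phase_coord (R : realType) (n : nat) (i : 'I_n + 'I_n)
    (z : 'rV[R]_n * 'rV[R]_n) : R :=
  match i with inl j => z.1 0 j | inr j => z.2 0 j end.

Lemma pair_coords (R : realType) (n : nat) (z : 'rV[R]_n * 'rV[R]_n) :
  z = \sum_i phase_coord i z *: @phase_basis R n i.
Proof.
rewrite big_sumType/=; case: z => q p /=.
have -> : \sum_(i < n) q 0 i *: ((delta_mx 0 i, 0) : 'rV[R]_n * 'rV[R]_n) = (q, 0).
  rewrite {2}(row_coords q); elim/big_ind2 : _ => //.
    by move=> a _ b _ -> ->; congr pair; rewrite addr0.
  by move=> i _; congr pair; rewrite scaler0.
have -> : \sum_(i < n) p 0 i *: ((0, delta_mx 0 i) : 'rV[R]_n * 'rV[R]_n) = (0, p).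
  rewrite {2}(row_coords p); elim/big_ind2 : _ => //.
    by move=> a _ b _ -> ->; congr pair; rewrite addr0.
  by move=> i _; congr pair; rewrite scaler0.
by congr pair; rewrite ?addr0 ?add0r.
Qed.

Lemma phase_coord_le (R : realType) (n : nat) i (z : 'rV[R]_n * 'rV[R]_n) :
  `|phase_coord i z| <= `|z|.
Proof.
have /andP[z1 z2] : (`|z.1| <= `|z|) && (`|z.2| <= `|z|) by rewrite -prod_norm_le.
by case: i => i /=; apply: le_trans (coord_norm_le _ _) _.
Qed.

Definition clamp1 (R : realType) (r x : R) : R := Num.max (- r) (Num.min r x).

Lemma clamp1_id (R : realType) (r x : R) : `|x| <= r -> clamp1 r x = x.
Proof.
by rewrite ler_norml => /andP[rx xr]; rewrite /clamp1 min_r// max_r.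
Qed.

Lemma clamp1_le (R : realType) (r x : R) : 0 <= r -> `|clamp1 r x| <= r.
Proof.
move=> r0; rewrite /clamp1 ler_norml le_max lexx/= ge_max ge_min lexx/= andbT.
by rewrite (le_trans _ r0)// oppr_le0.
Qed.

Lemma clamp1_lip (R : realType) (r x y : R) : `|clamp1 r x - clamp1 r y| <= `|x - y|.
Proof.
have h1 := ler_norm (x - y); have h2 := ler_norm (y - x); rewrite distrC in h2.
rewrite /clamp1 !maxEle !minEle ler_norml.
by do ! case: ifPn; rewrite -?ltNge => *; apply/andP; split; lra.
Qed.

Definition clamp (R : realType) (n : nat) (r : R) (v : 'rV[R]_n) : 'rV[R]_n :=
  \row_i clamp1 r (v 0 i).

Lemma clamp_id (R : realType) (n : nat) (r : R) (v : 'rV[R]_n) :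
  `|v| <= r -> clamp r v = v.
Proof.
move=> vr; apply/rowP => i; rewrite mxE clamp1_id//.
exact: le_trans (coord_norm_le _ _) vr.
Qed.

Lemma clamp_le (R : realType) (n : nat) (r : R) (v : 'rV[R]_n) : 0 <= r ->
  `|clamp r v| <= r.
Proof. by move=> r0; apply: rv_norm_le => // i; rewrite mxE clamp1_le. Qed.

Lemma clamp_lip (R : realType) (n : nat) (r : R) (u v : 'rV[R]_n) :
  `|clamp r u - clamp r v| <= `|u - v|.
Proof.
apply: rv_norm_le => // i; rewrite !mxE (le_trans (clamp1_lip _ _ _))//.
by have := coord_norm_le (u - v) i; rewrite !mxE.
Qed.

Definition box (R : realType) (n : nat) (r b : R) : set ('rV[R]_n * 'rV[R]_n) :=
  [set z | `|z.1| <= r /\ `|z.2| <= b].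

Lemma closed_ball_compact (R : realType) (n : nat) (r : R) :
  compact [set v : 'rV[R]_n | `|v| <= r].
Proof.
apply: bounded_closed_compact.
  by exists r; split; [exact: num_real|move=> M rM v /= vr; rewrite (le_trans vr)// ltW].
apply: (@closed_comp _ _ (fun x : 'rV[R]_n => `|x|) [set y | y <= r]).
  by move=> x _; exact: norm_continuous.
exact: closed_le.
Qed.

Lemma box_compact (R : realType) (n : nat) (r b : R) : compact (@box R n r b).
Proof.
have -> : @box R n r b = [set v | `|v| <= r] `*` [set v | `|v| <= b] by [].
by apply: compact_setX; exact: closed_ball_compact.
Qed.

Lemma ball_convex (R : realType) (V : normedModType R) (x y : V) (r t : R) :
  `|x| <= r -> `|y| <= r -> 0 <= t <= 1 -> `|x + t *: (y - x)| <= r.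
Proof.
move=> xr yr /andP[t0 t1].
have -> : x + t *: (y - x) = (1 - t) *: x + t *: y.
  by rewrite scalerBl scale1r scalerBr -addrA [- _ + _]addrC.
rewrite (le_trans (ler_normD _ _))// !normrZ ger0_norm ?subr_ge0// [`|t|]ger0_norm//.
have -> : r = (1 - t) * r + t * r by ring.
by rewrite lerD// ler_wpM2l// subr_ge0.
Qed.

(** * Components of an open sublevel set *)

Lemma component_segment (R : realType) (V : normedModType R) (U : set V)
    (C : set V) (a b : V) : is_component U C -> C a ->
  (forall t : R, 0 <= t <= 1 -> U (a + t *: (b - a))) -> C b.
Proof.
move=> [x Ux ->] Ca ab.
pose S := (fun t : R => a + t *: (b - a)) @` `[0, 1]%classic.
have Sa : S a by exists 0; rewrite ?scale0r ?addr0//= in_itv/= lexx ler01.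
have Sb : S b.
  by exists 1; rewrite ?scale1r/= ?[a + _]addrC ?subrK//= in_itv/= lexx ler01.
have conS : connected S.
  apply: connected_continuous_connected.
    exact: segment_connected.
  apply: continuous_subspaceT => t; apply/differentiable_continuous/derivable1_diffP.
  by have := is_derive_line a (b - a) t.
have SU : S `<=` U by move=> _ [t /= t01 <-]; apply: ab; rewrite in_itv in t01.
rewrite (same_connected_component Ca).
exact: connected_component_max Sa SU conS _ Sb.
Qed.

(** Near [q] the derivative along [v] is at most some [- m < 0].  Hence a point [x]
    near [q] with [f x <= 0] has [f (x + s v) < 0] for small [s > 0].  With a fixed
    small shift [s0], the whole ball around [q] is carried into the sublevel set
    (there [f < m s0] since [f q <= 0]).  So [x + s v] is joined to a point [c] of
    [C] by way of [x + s0 v] and [c + s0 v], and tends to [x] as [s] tends to 0. *)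
Lemma closure_component_nbhs (R : realType) (V : normedModType R)
    (Omega : set V) (f : V -> R) (C : set V) (q v : V) :
  open Omega -> (forall x, Omega x -> differentiable f x) ->
  is_component (Omega `&` [set x | f x < 0]) C ->
  closure C q -> Omega q -> {for q, continuous ('D_v f)} -> 'D_v f q < 0 ->
  exists2 rho : R, 0 < rho &
    forall x, `|x - q| < rho -> f x <= 0 -> closure C x.
Proof.
move=> oO df Ccomp Cq Oq cD Dq.
have CU : C `<=` Omega `&` [set x | f x < 0].
  by have [x0 _ ->] := Ccomp; exact: connected_component_sub.
have near_ball (P : set V) : nbhs q P ->
    exists2 e : R, 0 < e & forall x, `|x - q| < e -> P x.
  move=> /nbhs_normP[e e0 eP]; exists e => // x xe; apply: eP => /=.
  by rewrite distrC.
have cf : {for q, continuous f} by exact/differentiable_continuous/df.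
have fq : f q <= 0.
  rewrite leNgt; apply/negP => fq0.
  have /cvgrPdist_lt/(_ _ fq0)/near_ball[e e0 eP] := cf.
  have [x [Cx xe]] : C `&` [set x | `|x - q| < e] !=set0.
    by apply: Cq; have := @cvgr_distC_lt _ _ _ _ _ id q cvg_id _ e0; exact.
  have := eP _ xe; have [_ /= fx] := CU _ Cx.
  by rewrite ltr_norml => /andP[_]; lra.
pose m := - 'D_v f q / 2.
have m0 : 0 < m by rewrite divr_gt0// oppr_gt0.
have [r0 r00 r0P] : exists2 r0 : R, 0 < r0 &
    forall x, `|x - q| < r0 -> Omega x /\ 'D_v f x <= - m.
  have /near_ball[e1 e10 e1P] : nbhs q Omega by exact: open_nbhs_nbhs.
  have /cvgrPdist_lt/(_ _ m0)/near_ball[e2 e20 e2P] := cD.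
  exists (Num.min e1 e2); first by rewrite lt_min e10.
  move=> x; rewrite lt_min => /andP[/e1P Ox /e2P].
  by rewrite ltr_norml => /andP[h _]; split => //; move: h; rewrite /m; lra.
(* A shift by [s v] with [s <= s0] moves a point by less than [r0 / 2]. *)
pose s0 := r0 / (2 * (`|v| + 1)).
have v1 : 0 < `|v| + 1 by rewrite ltr_wpDl.
have s00 : 0 < s0 by rewrite divr_gt0// mulr_gt0.
have ms0 : 0 < m * s0 by rewrite mulr_gt0.
have inball x s : `|x - q| < r0 / 2 -> 0 <= s <= s0 -> `|x + s *: v - q| < r0.
  move=> xq /andP[s_ge s_le]; rewrite addrAC (le_lt_trans (ler_normD _ _))//.
  rewrite normrZ (ger0_norm s_ge).
  have h : s * `|v| <= s0 * (`|v| + 1) by rewrite ler_pM// lerDl.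
  have h2 : s0 * (`|v| + 1) = r0 / 2 by rewrite /s0; field; rewrite gt_eqF.
  by move: xq h; rewrite h2; lra.
have descent x s : `|x - q| < r0 / 2 -> 0 <= s <= s0 -> f (x + s *: v) <= f x - m * s.
  move=> xq /andP[s_ge s_le].
  have gd (t : R) : 0 <= t <= s ->
      is_derive t 1 (f \o (fun t : R => x + t *: v)) ('D_v f (x + t *: v)).
    move=> /andP[t0 ts]; apply: is_derive_chain; first exact: is_derive_line.
    by apply/df/(r0P _ _).1/inball => //; rewrite t0 (le_trans ts).
  have [t /andP[t0 ts]] := @mean_value R _ (fun t => 'D_v f (x + t *: v)) 0 s s_ge gd.
  rewrite /= scale0r addr0 subr0 => e.
  have [_ h] : Omega (x + t *: v) /\ 'D_v f (x + t *: v) <= - m.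
    by apply/r0P/inball => //; rewrite t0 (le_trans ts).
  have := ler_wpM2r s_ge h; rewrite -e mulNr; lra.
have [r1 r10 r1P] : exists2 r1 : R, 0 < r1 &
    forall x, `|x - q| < r1 -> f x < m * s0.
  have /cvgrPdist_lt/(_ _ ms0)/near_ball[e e0 eP] := cf.
  exists e => // x /eP; rewrite ltr_norml => /andP[h _]; move: h fq; lra.
pose rho := Num.min r1 (r0 / 2).
have rho0 : 0 < rho by rewrite lt_min r10 divr_gt0.
exists rho => // x xq fx.
have [c [Cc cq]] : C `&` [set c | `|c - q| < rho] !=set0.
  by apply: Cq; have := @cvgr_distC_lt _ _ _ _ _ id q cvg_id _ rho0; exact.
have rhoE y : `|y - q| < rho -> `|y - q| < r0 / 2 /\ f y < m * s0.
  by rewrite lt_min => /andP[/r1P ? ?].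
have [[xq2 fx1] [cq2 fc1]] := (rhoE _ xq, rhoE _ cq).
have s0_in : 0 <= s0 <= s0 by rewrite lexx ltW.
have Uin y s : `|y - q| < r0 / 2 -> 0 <= s <= s0 -> f y - m * s < 0 ->
    (Omega `&` [set x | f x < 0]) (y + s *: v).
  move=> yq s_in neg; split; first exact: (r0P _ (inball _ _ yq s_in)).1.
  by apply: le_lt_trans neg; exact: descent.
have C1 : C (c + s0 *: v).
  apply: (component_segment Ccomp Cc) => t /andP[t0 t1].
  rewrite [c + s0 *: v]addrC addrK scalerA; apply: Uin => //.
    by rewrite mulr_ge0 ?ler_piMl// ltW.
  have [_ /= fc] := CU _ Cc.
  have h : 0 <= m * (t * s0) by apply: mulr_ge0; [exact: ltW|apply: mulr_ge0 => //; exact: ltW].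
  by move: fc h; lra.
have C2 : C (x + s0 *: v).
  apply: (component_segment Ccomp C1) => t t01.
  have -> : c + s0 *: v + t *: (x + s0 *: v - (c + s0 *: v)) =
      (c + t *: (x - c)) + s0 *: v.
    by rewrite opprD addrACA subrr addr0 addrAC.
  have cxq : `|c + t *: (x - c) - q| < rho.
    have -> : c + t *: (x - c) - q = (c - q) + t *: ((x - q) - (c - q)).
      by rewrite opprB addrA subrK addrAC.
    apply: le_lt_trans (_ : Num.max `|c - q| `|x - q| < rho).
      by apply: ball_convex => //; rewrite le_max lexx ?orbT.
    by rewrite gt_max cq.
  have [h1 h2] := rhoE _ cxq.
  by apply: Uin => //; rewrite subr_lt0.
have C3 s : 0 < s <= s0 -> C (x + s *: v).
  move=> /andP[s_gt s_le]; apply: (component_segment Ccomp C2) => t /andP[t0 t1].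
  have -> : x + s0 *: v + t *: (x + s *: v - (x + s0 *: v)) =
      x + (s0 + t * (s - s0)) *: v.
    rewrite opprD addrACA subrr add0r -scalerBl scalerA -addrA -scalerDl//.
  have pos : 0 < s0 + t * (s - s0).
    have : t * (s0 - s) <= s0 - s by rewrite ler_piMl// subr_ge0.
    lra.
  apply: Uin => //.
    rewrite ltW//= gerDl mulr_ge0_le0// subr_le0//.
  by rewrite subr_lt0 (le_lt_trans fx)// mulr_gt0.
move=> N /nbhs_normP[e e0 eN].
pose s := Num.min s0 (e / (2 * (`|v| + 1))).
have s_gt : 0 < s by rewrite lt_min s00 divr_gt0// mulr_gt0.
exists (x + s *: v); split; first by apply: C3; rewrite s_gt ge_min lexx.
apply: eN => /=; rewrite opprD addrA subrr add0r normrN normrZ gtr0_norm//.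
apply: (@le_lt_trans _ _ (e / 2)); last by rewrite ltr_pdivrMr// ltr_pMr// ltr1n.
apply: (@le_trans _ _ (e / (2 * (`|v| + 1)) * (`|v| + 1))).
  apply: ler_pM => //; first exact: ltW.
    by rewrite ge_min lexx orbT.
  by rewrite lerDl.
by rewrite le_eqVlt; apply/orP; left; apply/eqP; field; rewrite gt_eqF.
Qed.

(** * Partial derivatives on a product *)

(** The difference quotients coincide, so a directional derivative of [f] along a
    factor exists exactly when that of the slice does, and they are equal. *)
Lemma fst_slice_quotient (R : realType) (V W : normedModType R) (f : V * W -> R)
    (u q : V) (p : W) :
  (fun h : R => h^-1 *: ((f \o shift (q, p)) (h *: (u, 0)) - f (q, p))) =
  (fun h : R => h^-1 *: (((fun x => f (x, p)) \o shift q) (h *: u) - f (q, p))).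
Proof.
apply/funext => h /=; congr (_ *: (f _ - _)).
by rewrite [LHS]surjective_pairing/= scaler0 add0r.
Qed.

Lemma snd_slice_quotient (R : realType) (V W : normedModType R) (f : V * W -> R)
    (q : V) (u p : W) :
  (fun h : R => h^-1 *: ((f \o shift (q, p)) (h *: (0, u)) - f (q, p))) =
  (fun h : R => h^-1 *: (((fun y => f (q, y)) \o shift p) (h *: u) - f (q, p))).
Proof.
apply/funext => h /=; congr (_ *: (f _ - _)).
by rewrite [LHS]surjective_pairing/= scaler0 add0r.
Qed.

Lemma derive_fst_slice (R : realType) (V W : normedModType R) (f : V * W -> R)
    (u q : V) (p : W) : 'D_(u, 0) f (q, p) = 'D_u (fun x => f (x, p)) q.
Proof. by rewrite /derive fst_slice_quotient. Qed.

Lemma derivable_fst_slice (R : realType) (V W : normedModType R) (f : V * W -> R)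
    (u q : V) (p : W) :
  derivable f (q, p) (u, 0) -> derivable (fun x => f (x, p)) q u.
Proof. by rewrite /derivable fst_slice_quotient. Qed.

Lemma derive_snd_slice (R : realType) (V W : normedModType R) (f : V * W -> R)
    (q : V) (u p : W) : 'D_(0, u) f (q, p) = 'D_u (fun y => f (q, y)) p.
Proof. by rewrite /derive snd_slice_quotient. Qed.

Lemma fst_continuous (V W : topologicalType) : continuous (@fst V W).
Proof. by move=> [a b]; exact: cvg_fst. Qed.

Lemma snd_continuous (V W : topologicalType) : continuous (@snd V W).
Proof. by move=> [a b]; exact: cvg_snd. Qed.

(** * The dot product *)

Section Dotv.
Variables (R : realType) (n : nat).
Implicit Types u v w : 'rV[R]_n.

Lemma dotvC u v : dotv u v = dotv v u.
Proof. by apply: eq_bigr => i _; rewrite mulrC. Qed.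

Lemma dotvZl a u v : dotv (a *: u) v = a * dotv u v.
Proof. by rewrite mulr_sumr; apply: eq_bigr => i _; rewrite mxE mulrA. Qed.

Lemma dotvZr a u v : dotv u (a *: v) = a * dotv u v.
Proof. by rewrite dotvC dotvZl dotvC. Qed.

Lemma dotv0l v : dotv 0 v = 0.
Proof. by apply: big1 => i _; rewrite mxE mul0r. Qed.

Lemma dotv_gt0 v : v != 0 -> 0 < dotv v v.
Proof.
move=> v0; rewrite lt0r sumr_ge0 ?andbT; last by move=> i _; rewrite -expr2 sqr_ge0.
apply: contra v0 => /eqP h; apply/eqP/rowP => i; rewrite mxE.
have := psumr_eq0P _ h; move/(_ (fun j _ => sqr_ge0 (v 0 j)) i isT)/eqP.
by rewrite mulf_eq0 orbb => /eqP.
Qed.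

Lemma dotv_le v : dotv v v <= n%:R * `|v| ^+ 2.
Proof.
have -> : n%:R * `|v| ^+ 2 = \sum_(i < n) `|v| ^+ 2 by rewrite sumr_const card_ord mulr_natl.
apply: ler_sum => i _; rewrite -expr2 -real_normK ?num_real//.
by rewrite lerXn2r ?nnegrE// coord_norm_le.
Qed.

Lemma derive_dotv (f : 'rV[R]_n -> R) x v : differentiable f x ->
  'D_v f x = dotv (gradient f x) v.
Proof.
move=> df; rewrite {1}(row_coords v) derive_lin_sum//; apply: eq_bigr => i _.
by rewrite mxE mulrC.
Qed.

Lemma dotv_cont (S : topologicalType) (f g : S -> 'rV[R]_n) (x : S) :
  {for x, continuous f} -> {for x, continuous g} ->
  {for x, continuous (fun y => dotv (f y) (g y))}.
Proof.
move=> cf cg; rewrite /prop_for /continuous_at /dotv.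
apply: (@cvg_big R 'I_n +%R 0 xpredT (@add_continuous R) _ _ _
  (fun i y => f y 0 i * g y 0 i)) => i _.
apply: cvgM.
  by apply: (@continuous_comp _ _ _ f (fun v : 'rV[R]_n => v 0 i)) => //; exact: coord_continuous.
by apply: (@continuous_comp _ _ _ g (fun v : 'rV[R]_n => v 0 i)) => //; exact: coord_continuous.
Qed.

End Dotv.

(** * Kinetic energy *)

Section Kinetic.
Variables (R : realType) (n : nat) (Omega : set 'rV[R]_n)
  (B : 'rV[R]_n -> 'M[R]_n).
Local Notation V2 := ('rV[R]_n * 'rV[R]_n)%type.
Local Notation T := (kinetic B).
Hypotheses (B_pos : forall q, Omega q -> posdef_mx (B q))
  (T_C2 : class_C 2 (Omega `*` [set: 'rV[R]_n]) T).

Lemma kinetic_differentiable z : Omega z.1 -> differentiable T z.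
Proof. by move=> Oz; have [d _] := T_C2; apply: d. Qed.

Lemma kinetic_derive_differentiable v z : Omega z.1 -> differentiable ('D_v T) z.
Proof. by move=> Oz; have [_ /(_ v)[d _]] := T_C2; apply: d. Qed.

Lemma kinetic_derive2_cont v w z : Omega z.1 -> {for z, continuous ('D_w ('D_v T))}.
Proof. by move=> Oz; have [_ /(_ v)[_ /(_ w) d]] := T_C2; apply: d. Qed.

Lemma kinetic_scale q p (l : R) : T (q, l *: p) = l ^+ 2 * T (q, p).
Proof.
rewrite /kinetic /mxapp /= -scalemxAl dotvZl dotvZr expr2 !mulrA.
by congr (_ * _); rewrite -mulrA mulrC.
Qed.

Lemma kinetic_gt0 q p : Omega q -> p != 0 -> 0 < T (q, p).
Proof. by move=> Oq p0; rewrite mulr_gt0// ?invr_gt0// B_pos. Qed.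

Lemma derive_q_kinetic_scale q p u (l : R) : Omega q ->
  'D_(u, 0) T (q, l *: p) = l ^+ 2 * 'D_(u, 0) T (q, p).
Proof.
move=> Oq; rewrite !derive_fst_slice.
have -> : (fun x => T (x, l *: p)) = (l ^+ 2) \*: (fun x => T (x, p)).
  by apply/funext => x; rewrite kinetic_scale.
rewrite deriveZ//; apply: derivable_fst_slice.
by apply: diff_derivable; exact: kinetic_differentiable.
Qed.

(** Both sides are the derivative at [s] of [T (q, r p) = r^2 T (q, p)] in [r].
    The case [s = 1] is Euler's identity; [s = 0] shows that the field vanishes
    where the momentum does. *)
Lemma derive_p_kinetic q p (s : R) : Omega q ->
  'D_(0, p) T (q, s *: p) = 2 * s * T (q, p).
Proof.
move=> Oq.
have h1 : is_derive s 1 (T \o (fun r : R => (q, 0) + r *: ((0, p) : V2)))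
    ('D_(0, p) T ((q, 0) + s *: ((0, p) : V2))).
  apply: is_derive_chain; first exact: is_derive_line.
  by apply: kinetic_differentiable; rewrite /= scaler0 addr0.
have e (r : R) : (q, 0) + r *: ((0, p) : V2) = (q, r *: p).
  by rewrite [LHS]surjective_pairing/= scaler0 addr0 add0r.
have h2 : is_derive s 1 (T \o (fun r : R => (q, 0) + r *: ((0, p) : V2)))
    (2 * s * T (q, p)).
  have -> : T \o (fun r : R => (q, 0) + r *: ((0, p) : V2)) =
      (T (q, p)) \*: ((@id R) ^+ 2).
    by apply/funext => r; rewrite /= e kinetic_scale mulrC.
  have := is_deriveZ (T (q, p)) (@is_deriveX _ _ id 2 s (1 : R) 1 (is_derive_id s (1 : R))).
  move=> h; apply: (is_derive_eq h); rewrite /GRing.scale/=; ring.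
rewrite -e; have <- := @derive_val _ _ _ _ _ _ _ h1.
exact: @derive_val _ _ _ _ _ _ _ h2.
Qed.

(** [T] and its derivatives in [q] are homogeneous of degree 2 in [p], so it is
    enough to bound them on the compact set [|q| <= r], [|p| = 1], where [T] is
    positive and all of them are continuous. *)
Lemma kinetic_bounds (r : R) : (forall x, `|x| <= r -> Omega x) ->
  exists c N : R, [/\ 0 < c, 0 <= N,
    forall q p, `|q| <= r -> c * `|p| ^+ 2 <= T (q, p) &
    forall q p i, `|q| <= r ->
      `|'D_(delta_mx 0 i, 0) T (q, p)| <= N * `|p| ^+ 2].
Proof.
move=> rO.
pose S : set V2 := box r 1 `&` [set z | `|z.2| = 1].
have cS : compact S.
  apply: compact_closedI; first exact: box_compact.
  apply: (@closed_comp _ _ (fun z : V2 => `|z.2|) [set y | y = 1]).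
    by move=> z _; apply: continuous_comp; [exact: cvg_snd|exact: norm_continuous].
  exact: closed_eq.
have unit p : p != 0 -> exists p1, `|p1| = 1 /\ p = `|p| *: p1 :> 'rV[R]_n.
  move=> p0; have np : `|p| != 0 by rewrite normr_eq0.
  exists (`|p|^-1 *: p); split; last by rewrite scalerA divff// scale1r.
  by rewrite normrZ normfV normr_id mulVf.
have T0 q : T (q, 0) = 0 by rewrite -(scale0r 0) kinetic_scale expr0n mul0r.
have [c c0 cP] : exists2 c : R, 0 < c & forall z, S z -> c <= T z.
  have [S0|S0] := pselect (S !=set0); last first.
    by exists 1 => // x Sx; exfalso; apply: S0; exists x.
  have [|c] := @compact_EVT_min _ R T S S0 cS.
    apply: continuous_in_subspaceT => x; rewrite inE => -[[xr _] _].
    by apply/differentiable_continuous/kinetic_differentiable/rO.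
  rewrite inE => -[[c1 _] /= c2] cmin; exists (T c).
    case: c c1 c2 {cmin} => q p /= q1 p1; apply: kinetic_gt0; first exact: rO.
    by rewrite -normr_gt0 p1.
  by move=> z Sz; apply: cmin; rewrite inE.
have /choice[N NP] (i : 'I_n) : exists N : R, 0 <= N /\
    forall z, S z -> `|'D_(delta_mx 0 i, 0) T z| <= N.
  have [|N N0 NP] := @compact_bounded_cont R V2 S ('D_(delta_mx 0 i, 0) T) cS.
    move=> z [[zr _] _].
    by apply/differentiable_continuous/kinetic_derive_differentiable/rO.
  by exists N.
exists c, (\sum_i N i); split => //.
- by apply: sumr_ge0 => i _; exact: (NP i).1.
- move=> q p qr; have [->|p0] := eqVneq p 0; first by rewrite T0 normr0 expr0n mulr0.
  have [p1 [p11 pE]] := unit p p0; rewrite {2}pE kinetic_scale mulrC.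
  by rewrite ler_wpM2l ?sqr_ge0// cP//; split; [split; rewrite /= ?p11|].
- move=> q p i qr; have [->|p0] := eqVneq p 0.
    have := derive_q_kinetic_scale 0 (delta_mx 0 i) 0 (rO _ qr).
    by rewrite scale0r expr0n mul0r => ->; rewrite !normr0 expr0n mulr0.
  have [p1 [p11 pE]] := unit p p0; rewrite {1}pE derive_q_kinetic_scale; last exact: rO.
  rewrite normrM ger0_norm ?sqr_ge0// mulrC ler_wpM2r ?sqr_ge0//.
  apply: le_trans ((NP i).2 (q, p1) _) _; first by split; [split; rewrite /= ?p11|].
  by rewrite (bigD1 i)//= lerDl sumr_ge0// => j _; exact: (NP j).1.
Qed.

End Kinetic.

(** * The Hamiltonian vector field *)

Definition ham_field (R : realType) (n : nat)
    (H : 'rV[R]_n * 'rV[R]_n -> R) (z : 'rV[R]_n * 'rV[R]_n) :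
    'rV[R]_n * 'rV[R]_n :=
  (gradient (fun y => H (z.1, y)) z.2, - gradient (fun x => H (x, z.2)) z.1).

Section HamiltonianField.
Variables (R : realType) (n : nat) (Omega : set 'rV[R]_n)
  (B : 'rV[R]_n -> 'M[R]_n) (Pi : 'rV[R]_n -> R).
Local Notation V2 := ('rV[R]_n * 'rV[R]_n)%type.
Local Notation T := (kinetic B).
Local Notation H := (hamiltonian B Pi).
Hypotheses (T_C2 : class_C 2 (Omega `*` [set: 'rV[R]_n]) T)
  (Pi_C2 : class_C 2 Omega Pi).

Lemma potential_differentiable q : Omega q -> differentiable Pi q.
Proof. by move=> Oq; have [d _] := Pi_C2; exact: d. Qed.

Lemma potential_derive_differentiable v q : Omega q -> differentiable ('D_v Pi) q.
Proof. by move=> Oq; have [_ /(_ v)[d _]] := Pi_C2; exact: d. Qed.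

Lemma derive_hamiltonian (v z : V2) : Omega z.1 ->
  'D_v H z = 'D_v T z + 'D_(v.1) Pi z.1.
Proof.
move=> Oz; have dT : derivable T z v.
  by apply: diff_derivable; exact: (kinetic_differentiable T_C2).
have dPi : derivable (fun z : V2 => Pi z.1) z v.
  have := @diff_derivable _ _ _ Pi z.1 v.1 (potential_differentiable Oz); exact.
have := deriveD dT dPi; exact.
Qed.

Lemma ham_field1 z i : Omega z.1 ->
  (ham_field H z).1 0 i = 'D_(0, delta_mx 0 i) T z.
Proof.
move=> Oz; rewrite mxE -derive_snd_slice -surjective_pairing derive_hamiltonian//=.
by rewrite derive0 addr0.
Qed.

Lemma ham_field2 z i : Omega z.1 ->
  (ham_field H z).2 0 i = - ('D_(delta_mx 0 i, 0) T z + 'D_(delta_mx 0 i) Pi z.1).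
Proof.
move=> Oz; rewrite !mxE.
by rewrite -(derive_fst_slice H) -surjective_pairing derive_hamiltonian.
Qed.

Lemma derive_kinetic_sum z (v : V2) : Omega z.1 ->
  'D_v T z = \sum_i v.1 0 i * 'D_(delta_mx 0 i, 0) T z +
             \sum_i v.2 0 i * 'D_(0, delta_mx 0 i) T z.
Proof.
move=> Oz; rewrite {1}(pair_coords v) derive_lin_sum ?big_sumType//.
exact: (kinetic_differentiable T_C2).
Qed.

Lemma derive_potential_sum q (v : 'rV[R]_n) : Omega q ->
  'D_v Pi q = \sum_i v 0 i * 'D_(delta_mx 0 i) Pi q.
Proof.
move=> Oq; rewrite {1}(row_coords v) derive_lin_sum//.
exact: potential_differentiable.
Qed.

(** In coordinates the terms [H_q_i H_p_i - H_p_i H_q_i] cancel. *)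
Lemma energy_derivative (z : R -> V2) (t : R) : Omega (z t).1 ->
  is_derive t 1 (fun s => (z s).1) (ham_field H (z t)).1 ->
  is_derive t 1 (fun s => (z s).2) (ham_field H (z t)).2 ->
  is_derive t 1 (H \o z) 0.
Proof.
move=> Oz d1 d2.
have dz : is_derive t 1 z (ham_field H (z t)).
  have := is_derive_pair d1 d2; rewrite -surjective_pairing.
  by congr is_derive; apply/funext => s; rewrite -surjective_pairing.
have hT := is_derive_chain dz (kinetic_differentiable T_C2 Oz).
have hP := is_derive_chain d1 (potential_differentiable Oz).
apply: (is_derive_eq (is_deriveD hT hP)).
rewrite derive_kinetic_sum// derive_potential_sum// -!big_split/=.
apply: big1 => i _; rewrite ham_field1// ham_field2//; ring.
Qed.

Lemma ham_field_lipschitz (r b : R) : (forall x, `|x| <= r -> Omega x) ->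
  exists2 K : R, 0 < K & forall x y, box r b x -> box r b y ->
    `|ham_field H y - ham_field H x| <= K * `|y - x|.
Proof.
move=> rO.
have boxO : box r b `<=` Omega `*` [set: 'rV[R]_n] by move=> z [zr _]; split => //; exact: rO.
have box_convex (x y : V2) (t : R) : box r b x -> box r b y -> 0 <= t <= 1 ->
    box r b (x + t *: (y - x)).
  by move=> [x1 x2] [y1 y2] t01; split; exact: ball_convex.
have lipT v : exists2 K : R, 0 <= K &
    forall x y, box r b x -> box r b y -> `|'D_v T y - 'D_v T x| <= K * `|y - x|.
  apply: (@C1_lipschitz R V2 _ (@phase_basis R n) (@phase_coord R n) _ _ _ (@pair_coords R n)
    (@phase_coord_le R n) _ _ boxO (@box_compact R n r b) box_convex).
    by move=> z [Oz _]; exact: (kinetic_derive_differentiable T_C2).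
  by move=> w z [Oz _]; exact: (kinetic_derive2_cont T_C2).
have lipP v : exists2 K : R, 0 <= K &
    forall x y, `|x| <= r -> `|y| <= r -> `|'D_v Pi y - 'D_v Pi x| <= K * `|y - x|.
  apply: (@C1_lipschitz R 'rV[R]_n _ (fun i => delta_mx 0 i) (fun i v => v 0 i) Omega
    [set x | `|x| <= r] _ (@row_coords R n)) => //.
  - by move=> i w; exact: coord_norm_le.
  - by move=> x Ox; exact: potential_derive_differentiable.
  - by move=> w x Ox; have [_ /(_ v)[_ /(_ w) d]] := Pi_C2; exact: d.
  - exact: closed_ball_compact.
  - by move=> x y t; exact: ball_convex.
have /choice[K1 K1P] (i : 'I_n) : exists K : R, 0 <= K /\ forall x y, box r b x -> box r b y ->
    `|'D_(0, delta_mx 0 i) T y - 'D_(0, delta_mx 0 i) T x| <= K * `|y - x|.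
  by have [K ? ?] := lipT (0, delta_mx 0 i); exists K.
have /choice[K2 K2P] (i : 'I_n) : exists K : R, 0 <= K /\ forall x y, box r b x -> box r b y ->
    `|'D_(delta_mx 0 i, 0) T y - 'D_(delta_mx 0 i, 0) T x| <= K * `|y - x|.
  by have [K ? ?] := lipT (delta_mx 0 i, 0); exists K.
have /choice[K3 K3P] (i : 'I_n) : exists K : R, 0 <= K /\ forall x y, `|x| <= r -> `|y| <= r ->
    `|'D_(delta_mx 0 i) Pi y - 'D_(delta_mx 0 i) Pi x| <= K * `|y - x|.
  by have [K ? ?] := lipP (delta_mx 0 i); exists K.
pose K := 1 + \sum_i (K1 i + K2 i + K3 i).
have S0 (i : 'I_n) : 0 <= K1 i + K2 i + K3 i.
  by rewrite !addr_ge0//; [exact: (K1P i).1|exact: (K2P i).1|exact: (K3P i).1].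
have SK i : K1 i + K2 i + K3 i <= K.
  by rewrite /K (bigD1 i)//= addrCA lerDl addr_ge0// sumr_ge0.
have K0 : 0 < K by rewrite ltr_wpDr// sumr_ge0.
exists K => // x y bx by_.
have [Ox Oy] : Omega x.1 /\ Omega y.1 by split; apply: rO; [exact: bx.1|exact: by_.1].
have yx0 := normr_ge0 (y - x).
have Kyx0 : 0 <= K * `|y - x| by rewrite mulr_ge0// ltW.
rewrite prod_norm_le; apply/andP; split; apply: rv_norm_le => // i.
- have -> : (ham_field H y - ham_field H x).1 0 i =
      (ham_field H y).1 0 i - (ham_field H x).1 0 i by rewrite !mxE.
  rewrite !ham_field1// (le_trans ((K1P i).2 _ _ bx by_))// ler_wpM2r//.
  by rewrite (le_trans _ (SK i))// -addrA lerDl addr_ge0 ?(K2P i).1 ?(K3P i).1.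
- have -> : (ham_field H y - ham_field H x).2 0 i =
      (ham_field H y).2 0 i - (ham_field H x).2 0 i by rewrite !mxE.
  rewrite !ham_field2// -opprD normrN opprD addrACA (le_trans (ler_normD _ _))//.
  have h3 := (K3P i).2 _ _ bx.1 by_.1.
  apply: le_trans (lerD ((K2P i).2 _ _ bx by_) h3) _.
  apply: (@le_trans _ _ ((K2 i + K3 i) * `|y - x|)).
    rewrite mulrDl lerD2l ler_wpM2l ?(K3P i).1//.
    by have := lexx `|y - x|; rewrite [in X in X -> _]prod_norm_le => /andP[].
  by rewrite ler_wpM2r// (le_trans _ (SK i))// -addrA lerDr (K1P i).1.
Qed.

(** Clamping each coordinate does not increase sup-norm distances, and its values
    lie in the box where the field is Lipschitz.  A bound on the field follows
    because it vanishes at the origin. *)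
Lemma clamped_field (r b : R) : 0 <= r -> 0 <= b ->
  (forall x, `|x| <= r -> Omega x) -> ham_field H 0 = 0 ->
  let X z := ham_field H (clamp r z.1, clamp b z.2) in
  exists M K : R, [/\ 0 < K, forall x, `|X x| <= M &
    forall x y, `|X x - X y| <= K * `|x - y|].
Proof.
move=> r0 b0 rO X0 X.
have [K K0 KP] := ham_field_lipschitz b rO.
have bc (z : V2) : box r b (clamp r z.1, clamp b z.2) by split; exact: clamp_le.
exists (K * Num.max r b), K; split => // [x|x y].
  rewrite -[X x]subr0 -X0 (le_trans (KP _ _ _ (bc x)))//.
    by split; rewrite normr0.
  rewrite subr0 ler_wpM2l//; first exact: ltW.
  by rewrite prod_norm_le !le_max !clamp_le// orbT.
rewrite (le_trans (KP _ _ (bc y) (bc x)))// ler_wpM2l//; first exact: ltW.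
have /andP[h1 h2] : (`|(x - y).1| <= `|x - y|) && (`|(x - y).2| <= `|x - y|).
  by rewrite -prod_norm_le.
rewrite prod_norm_le; apply/andP; split; first exact: le_trans (clamp_lip _ _ _) h1.
exact: le_trans (clamp_lip _ _ _) h2.
Qed.

Lemma ham_field0 : Omega 0 -> gradient Pi 0 = 0 -> ham_field H 0 = 0.
Proof.
move=> O0 gPi0; rewrite [LHS]surjective_pairing [RHS]surjective_pairing.
congr pair; apply/rowP => i.
  rewrite ham_field1// mxE.
  have := derive_p_kinetic T_C2 (delta_mx 0 i) 0 O0.
  by rewrite scale0r mulr0 mul0r.
rewrite ham_field2// mxE.
have := derive_q_kinetic_scale T_C2 0 (delta_mx 0 i) 0 O0.
rewrite scale0r expr0n mul0r => ->.
by have /rowP/(_ i) := gPi0; rewrite !mxE => ->; rewrite addr0 oppr0.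
Qed.

(** The term [2 T] is Euler's identity. *)
Lemma virial z : Omega z.1 ->
  dotv (ham_field H z).1 z.2 + dotv z.1 (ham_field H z).2 =
  2 * T z - 'D_(z.1, 0) T z - dotv (gradient Pi z.1) z.1.
Proof.
move=> Oz.
have e1 : dotv (ham_field H z).1 z.2 = 2 * T z.
  have := derive_p_kinetic T_C2 z.2 1 Oz.
  rewrite scale1r mulr1 -surjective_pairing => <-.
  rewrite derive_kinetic_sum//= [X in _ = X + _]big1 ?add0r; last first.
    by move=> i _; rewrite mxE mul0r.
  by apply: eq_bigr => i _; rewrite ham_field1// mulrC.
have e2 : dotv z.1 (ham_field H z).2 =
    - 'D_(z.1, 0) T z - dotv (gradient Pi z.1) z.1.
  rewrite -derive_dotv; last exact: potential_differentiable.
  rewrite derive_kinetic_sum//= [X in - (_ + X)]big1 ?addr0; last first.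
    by move=> i _; rewrite mxE mul0r.
  rewrite derive_potential_sum// -opprD -big_split/= -sumrN; apply: eq_bigr => i _.
  by rewrite ham_field2// mulrN mulrDr.
by rewrite e1 e2 addrA.
Qed.

Lemma derive_q_kinetic_le (r c N : R) z : Omega z.1 ->
  (forall i, `|'D_(delta_mx 0 i, 0) T z| <= N * `|z.2| ^+ 2) -> 0 <= N ->
  `|z.1| <= r -> r * (n%:R * N) <= c ->
  `|'D_(z.1, 0) T z| <= c * `|z.2| ^+ 2.
Proof.
move=> Oz zN N0 zr rc.
rewrite derive_kinetic_sum//= [X in _ + X]big1 ?addr0; last first.
  by move=> i _; rewrite mxE mul0r.
apply: le_trans (ler_norm_sum _ _ _) _.
apply: (@le_trans _ _ (\sum_(i < n) r * (N * `|z.2| ^+ 2))).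
  apply: ler_sum => i _; rewrite normrM ler_pM//.
  exact: le_trans (coord_norm_le _ _) zr.
rewrite sumr_const card_ord -mulr_natl.
have -> : n%:R * (r * (N * `|z.2| ^+ 2)) = r * (n%:R * N) * `|z.2| ^+ 2 by ring.
by rewrite ler_wpM2r// sqr_ge0.
Qed.

End HamiltonianField.

Lemma is_derive_dotv (R : realType) (n : nat) (q p : R -> 'rV[R]_n)
    (v w : 'rV[R]_n) (t : R) :
  (forall i, is_derive t 1 (fun s : R => q s 0 i) (v 0 i)) ->
  (forall i, is_derive t 1 (fun s : R => p s 0 i) (w 0 i)) ->
  is_derive t 1 (fun s => dotv (q s) (p s)) (dotv v (p t) + dotv (q t) w).
Proof.
move=> qv pw.
have h i : is_derive t 1 ((fun s : R => q s 0 i) * (fun s : R => p s 0 i))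
    (v 0 i * p t 0 i + q t 0 i * w 0 i).
  apply: (is_derive_eq (is_deriveM (qv i) (pw i))).
  by rewrite /GRing.scale/= addrC; congr (_ + _); rewrite mulrC.
have := is_derive_sum h; rewrite big_split/=.
by congr is_derive; apply/funext => s; rewrite fct_sumE.
Qed.

Lemma eball_sup_norm (R : realType) (n : nat) (eps : R) (x : 'rV[R]_n) :
  0 < eps -> `|x| <= eps / n.+1%:R -> eball eps x.
Proof.
move=> eps0 xe; rewrite /eball/=.
have -> : eps = Num.sqrt (eps ^+ 2) by rewrite sqrtr_sqr gtr0_norm.
rewrite ltr_sqrt ?exprn_gt0//; apply: le_lt_trans (dotv_le x) _.
apply: (@le_lt_trans _ _ (n%:R * (eps / n.+1%:R) ^+ 2)).
  by rewrite ler_wpM2l// lerXn2r ?nnegrE// divr_ge0// ltW.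
rewrite expr_div_n mulrCA -[ltRHS]mulr1 ltr_pM2l ?exprn_gt0//.
rewrite ltr_pdivrMr ?exprn_gt0// mul1r -natrX ltr_nat expnS expn1.
by rewrite (@leq_trans n.+1)// leq_pmulr.
Qed.

(** * The zero energy level over the component *)

(** The radius [r] is so small that [T] dominates [D_(q, 0) T] ([r_small]), and [b]
    so large that states of zero energy over [|q| <= r] have [|p| < b], that is,
    lie inside the box on which the clamped field [X] is the Hamiltonian one. *)
Section EnergyLevel.
Variables (R : realType) (n : nat) (Omega : set 'rV[R]_n)
  (B : 'rV[R]_n -> 'M[R]_n) (Pi : 'rV[R]_n -> R) (C : set 'rV[R]_n) (r b c N : R).
Local Notation V2 := ('rV[R]_n * 'rV[R]_n)%type.
Local Notation T := (kinetic B).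
Local Notation H := (hamiltonian B Pi).
Hypotheses (Omega_open : open Omega)
  (B_pos : forall q, Omega q -> posdef_mx (B q))
  (T_C2 : class_C 2 (Omega `*` [set: 'rV[R]_n]) T)
  (Pi_C2 : class_C 2 Omega Pi) (Pi0 : Pi 0 = 0)
  (C_comp : is_component (Omega `&` [set q | Pi q < 0]) C) (C0 : closure C 0).
Hypotheses (r0 : 0 < r) (b0 : 0 < b) (c0 : 0 < c) (N0 : 0 <= N)
  (rO : forall x, `|x| <= r -> Omega x)
  (T_ge : forall q p, `|q| <= r -> c * `|p| ^+ 2 <= T (q, p))
  (dT_le : forall q p i, `|q| <= r ->
    `|'D_(delta_mx 0 i, 0) T (q, p)| <= N * `|p| ^+ 2)
  (r_small : r * (n%:R * N) <= c)
  (b_large : forall x, `|x| <= r -> - Pi x < c * b ^+ 2)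
  (Pi_decr : forall q, `|q| <= r -> closure C q -> q != 0 ->
    dotv (gradient Pi q) q < 0).

Definition energy_level : set V2 :=
  [set z | [/\ `|z.1| <= r, closure C z.1 & H z = 0]].

Let X (z : V2) := ham_field H (clamp r z.1, clamp b z.2).

Let dPi q : Omega q -> differentiable Pi q.
Proof. exact: potential_differentiable. Qed.

Let XE z : `|z.1| <= r -> `|z.2| <= b -> X z = ham_field H z.
Proof. by move=> h1 h2; rewrite /X !clamp_id// -surjective_pairing. Qed.

Let T_ge0 z : `|z.1| <= r -> 0 <= T z.
Proof.
move=> zr; have := @T_ge z.1 z.2 zr; rewrite -surjective_pairing; apply: le_trans.
by rewrite mulr_ge0 ?sqr_ge0// ltW.
Qed.

Let level_potential z : H z = 0 -> T z = - Pi z.1.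
Proof. by move=> Hz; apply/eqP; rewrite -addr_eq0 -Hz. Qed.

Let level_momentum z : energy_level z -> `|z.2| < b.
Proof.
move=> [zr _ Hz].
have : c * `|z.2| ^+ 2 < c * b ^+ 2.
  apply: le_lt_trans (@b_large _ zr); rewrite -level_potential//.
  by have := @T_ge z.1 z.2 zr; rewrite -surjective_pairing.
by rewrite ltr_pM2l// ltr_pXn2r ?nnegrE// ltW.
Qed.

Let level_field z : energy_level z -> X z = ham_field H z.
Proof.
by move=> Az; have [zr _ _] := Az; apply: XE => //; exact/ltW/level_momentum.
Qed.

Lemma energy_level_compact : compact energy_level.
Proof.
have Hcont z : Omega z.1 -> {for z, continuous H}.
  move=> Oz; apply: continuousD.
    exact/differentiable_continuous/(kinetic_differentiable T_C2).
  apply: (@continuous_comp _ _ _ fst Pi); first exact: fst_continuous.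
  exact/differentiable_continuous/dPi.
apply: subclosed_compact (@box_compact R n r b) _ => [|z Az]; last first.
  by have [zr _ _] := Az; split => //; exact/ltW/level_momentum.
move=> z clz.
have clz1 (F : set 'rV[R]_n) : closed F ->
    (forall y, energy_level y -> F y.1) -> F z.1.
  move=> cF AF; apply: cF => U Uz.
  have [y [Ay Uy]] := clz (fst @^-1` U) (@fst_continuous _ _ z _ Uz).
  by exists y.1; split => //; exact: AF.
have zr : `|z.1| <= r.
  apply: (clz1 [set x | `|x| <= r]); last by move=> y [].
  by apply: compact_closed; [exact: norm_hausdorff|exact: closed_ball_compact].
split => //; first by apply: (clz1 (closure C)); [exact: closed_closure|move=> y []].
apply/eqP; rewrite -normr_eq0 eq_le normr_ge0 andbT leNgt; apply/negP => Hz0.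
have /cvgrPdist_lt/(_ _ Hz0) := Hcont z (@rO _ zr).
by move=> /clz[y [[_ _ ->]]]; rewrite subr0 ltxx.
Qed.

Definition virial_rate (z : V2) : R := dotv (X z).1 z.2 + dotv z.1 (X z).2.

(** The rate is at least [T - <grad Pi (q), q>].  If [q] is not 0 the second term
    is positive; if [q = 0] then [T = - Pi 0 = 0], whence [p = 0]. *)
Lemma virial_rate_gt0 z : energy_level z -> z != 0 -> 0 < virial_rate z.
Proof.
move=> Az z0; have [zr zC Hz] := Az; have Oz := @rO _ zr.
have zE : z = (z.1, z.2) by exact: surjective_pairing.
have Tz := @T_ge z.1 z.2 zr; rewrite -zE in Tz.
apply: (@lt_le_trans _ _ (T z - dotv (gradient Pi z.1) z.1)); last first.
  rewrite /virial_rate level_field// (virial T_C2 Pi_C2)// lerB//.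
  have zz i : `|'D_(delta_mx 0 i, 0) T z| <= N * `|z.2| ^+ 2.
    by have := @dT_le z.1 z.2 i zr; rewrite -zE.
  have := derive_q_kinetic_le T_C2 Oz zz N0 zr r_small.
  have := ler_norm ('D_(z.1, 0) T z); move: Tz; lra.
have [q0|q0] := eqVneq z.1 0; last first.
  by have := @Pi_decr _ zr zC q0; have := T_ge0 zr; lra.
exfalso; move/eqP: z0; apply; rewrite zE q0; congr pair.
apply/eqP; rewrite -normr_eq0 -sqrf_eq0 eq_le sqr_ge0 andbT -(@pmulr_rle0 _ c)//.
by apply: le_trans Tz _; rewrite level_potential// q0 Pi0 oppr0.
Qed.

(** Only the condition [q] in the closure of [C] needs an argument: [L > 0] forces
    [q] to be nonzero, energy is conserved as long as the orbit is inside the box,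
    so [Pi (q) = - T <= 0] there, and [closure_component_nbhs] applies with the
    radial direction. *)
Lemma energy_level_continues (z : R -> V2) (t : R) : phase_solves X z -> continuous z ->
  energy_level (z t) -> `|(z t).1| < r -> 0 < dotv (z t).1 (z t).2 ->
  exists2 d : R, 0 < d & forall s, t <= s <= t + d -> energy_level (z s).
Proof.
move=> zX cz Azt zt_r Lzt; have [zt_r' ztC Hzt] := Azt; have Ozt := @rO _ zt_r'.
have q0 : (z t).1 != 0 by apply: contraTneq Lzt => ->; rewrite dotv0l ltxx.
have [rho rho0 rhoP] : exists2 rho : R, 0 < rho &
    forall x, `|x - (z t).1| < rho -> Pi x <= 0 -> closure C x.
  apply: (closure_component_nbhs Omega_open dPi C_comp ztC Ozt (v := (z t).1)).
    exact/differentiable_continuous/(potential_derive_differentiable Pi_C2).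
  by rewrite derive_dotv; [exact: Pi_decr|exact: dPi].
have zt_b := level_momentum Azt.
pose e := Num.min rho (Num.min (r - `|(z t).1|) (b - `|(z t).2|)).
have e0 : 0 < e by rewrite !lt_min rho0 !subr_gt0 zt_r.
have [d d0 near_z] : exists2 d : R, 0 < d &
    forall s, t <= s <= t + d -> `|z s - z t| < e.
  have /cvgrPdist_lt/(_ _ e0)/nbhs_normP[d d0 dP] := cz t.
  exists (d / 2); first by rewrite divr_gt0.
  move=> s /andP[ts sd]; rewrite distrC; apply: dP => /=.
  by rewrite distrC ger0_norm ?subr_ge0//; move: d0 sd => /=; lra.
have coords s : t <= s <= t + d -> [/\ `|(z s).1 - (z t).1| < rho,
    `|(z s).1| < r & `|(z s).2| < b].
  move=> /near_z zs; have : `|z s - z t| <= `|z s - z t| by [].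
  rewrite [in X in X -> _]prod_norm_le => /andP[h1 h2].
  have {}h1 : `|(z s).1 - (z t).1| <= `|z s - z t| by exact: h1.
  have {}h2 : `|(z s).2 - (z t).2| <= `|z s - z t| by exact: h2.
  have /and3P[k1 k2 k3] : [&& `|z s - z t| < rho,
      `|z s - z t| < r - `|(z t).1| & `|z s - z t| < b - `|(z t).2|].
    by move: zs; rewrite !lt_min.
  split; first exact: le_lt_trans k1.
    have := ler_normD (z t).1 ((z s).1 - (z t).1); rewrite addrC subrK => h.
    by move: h h1 k2; lra.
  have := ler_normD (z t).2 ((z s).2 - (z t).2); rewrite addrC subrK => h.
  by move: h h2 k3; lra.
exists d; first exact: d0.
move=> s sd; have [k1 k2 k3] := coords s sd; have /andP[ts std] := sd.
have Hzs : H (z s) = 0.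
  have hd (x : R) : t <= x <= s -> is_derive x 1 (H \o z) (cst 0 x).
    move=> /andP[tx xs]; have [|_ xr xb] := coords x.
      by rewrite tx (le_trans xs).
    have Xx := XE (ltW xr) (ltW xb).
    apply: (energy_derivative T_C2 Pi_C2 (@rO _ (ltW xr))); rewrite -Xx;
      by apply: is_derive_rV => i; have [] := zX x i.
  have [x _] := @mean_value R (H \o z) (cst 0) t s ts hd.
  by rewrite /= mul0r Hzt subr0.
split; [exact: ltW| |exact: Hzs].
apply: rhoP k1 _.
by rewrite -oppr_ge0 -level_potential// T_ge0// ltW.
Qed.

(** Take [(q, l q)] with [q] in [C] near 0 and [l] such that
    [T (q, l q) = l^2 T (q, q)] equals [- Pi q].  Its momentum is small because
    [c |l q|^2 <= - Pi q], which tends to 0 with [q]. *)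
Lemma energy_level_small (e : R) : 0 < e ->
  exists x, [/\ energy_level x, `|x| < e & 0 < dotv x.1 x.2].
Proof.
move=> e0; have ce0 : 0 < c * e ^+ 2 by rewrite mulr_gt0 ?exprn_gt0.
have O0 : Omega 0 by apply: rO; rewrite normr0 ltW.
have CU : C `<=` Omega `&` [set q | Pi q < 0].
  by have [x0 _ ->] := C_comp; exact: connected_component_sub.
have cPi : {for 0, continuous Pi} by exact/differentiable_continuous/dPi.
have [q [Cq [[q_e q_r] q_Pi]]] : C `&` [set q | (`|q| < e /\ `|q| < r) /\
    - Pi q < c * e ^+ 2] !=set0.
  apply: C0.
  have h0 (d : R) : 0 < d -> nbhs (0 : 'rV[R]_n) [set q | `|q| < d].
    move=> /(@nbhs_dist _ _ (0 : 'rV[R]_n)).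
    suff -> : [set y : 'rV[R]_n | `|y - 0| < d] = [set q | `|q| < d] by [].
    by apply/funext => q /=; rewrite subr0.
  apply: filterI; first by apply: filterI; exact: h0.
  have /cvgrPdist_lt/(_ _ ce0) := cPi.
  by apply: filterS => q; rewrite Pi0 sub0r; apply: le_lt_trans; exact: ler_norm.
have [Oq /= Piq] := CU _ Cq.
have q0 : q != 0 by apply: contraTneq Piq => ->; rewrite Pi0 ltxx.
have Tq : 0 < T (q, q) by exact: (kinetic_gt0 B_pos).
pose l := Num.sqrt (- Pi q / T (q, q)).
have l2 : 0 < - Pi q / T (q, q) by rewrite divr_gt0// oppr_gt0.
have l0 : 0 < l by rewrite sqrtr_gt0.
have Tl : T (q, l *: q) = - Pi q.
  by rewrite kinetic_scale sqr_sqrtr ?divfK// ?gt_eqF// ltW.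
exists (q, l *: q); split.
- split => /=; [exact: ltW|exact: subset_closure|].
  by rewrite /hamiltonian Tl/= addNr.
- rewrite prod_normE gt_max q_e/=.
  have := @T_ge q (l *: q) (ltW q_r); rewrite Tl => h.
  have : c * `|l *: q| ^+ 2 < c * e ^+ 2 by exact: le_lt_trans h q_Pi.
  by rewrite ltr_pM2l// ltr_pXn2r ?nnegrE// ltW.
- by rewrite /= dotvZr mulr_gt0// dotv_gt0.
Qed.

Lemma energy_level_asymptotic : gradient Pi 0 = 0 -> exists z : R -> V2,
  [/\ phase_solves X z, z 0 != 0, forall t, t <= 0 -> energy_level (z t) &
      z t @[t --> -oo] --> (0 : V2)].
Proof.
move=> Pi_crit.
have O0 : Omega 0 by apply: rO; rewrite normr0 ltW.
have X00 : ham_field H 0 = 0 by exact: (ham_field0 T_C2 Pi_C2).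
have [M [K [K0 XM XK]]] := clamped_field T_C2 Pi_C2 (ltW r0) (ltW b0) rO X00.
have {}XM x : `|X x| <= M by exact: XM.
have {}XK x y : `|X x - X y| <= K * `|x - y| by exact: XK.
have X0 : X 0 = 0 by rewrite XE ?normr0 ?ltW.
have cX : continuous X by apply: (@lipschitz_cont _ _ _ _ K) => x y; exact: XK.
have cL : continuous (fun z : V2 => dotv z.1 z.2).
  by move=> x; apply: dotv_cont; [exact: fst_continuous|exact: snd_continuous].
have L0 : dotv (0 : V2).1 (0 : V2).2 = 0 by rewrite dotv0l.
have X_fst x : {for x, continuous (fun z => (X z).1)}.
  by apply: (@continuous_comp _ _ _ X fst); [exact: cX|exact: fst_continuous].
have X_snd x : {for x, continuous (fun z => (X z).2)}.
  by apply: (@continuous_comp _ _ _ X snd); [exact: cX|exact: snd_continuous].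
have cW : continuous virial_rate.
  move=> x; have h1 : {for x, continuous (fun z => dotv (X z).1 z.2)}.
    by apply: dotv_cont; [exact: X_fst|exact: snd_continuous].
  have h2 : {for x, continuous (fun z => dotv z.1 (X z).2)}.
    by apply: dotv_cont; [exact: fst_continuous|exact: X_snd].
  exact: (cvgD h1 h2).
have LW z : phase_solves X z -> forall t : R,
    is_derive t 1 ((fun z : V2 => dotv z.1 z.2) \o z) (virial_rate (z t)).
  by move=> zX t; apply: is_derive_dotv => i; have [] := zX t i.
have W_ge0 z : energy_level z -> 0 <= virial_rate z.
  move=> Az; have [->|z0] := eqVneq z 0; last by rewrite ltW// virial_rate_gt0.
  by rewrite /virial_rate dotvC !dotv0l addr0.
have A_r z : energy_level z -> `|z.1| <= r by case.
apply: (backward_asymptotic K0 XM XK X0 r0 energy_level_compact cL cW L0 LW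
  W_ge0 virial_rate_gt0 A_r _ energy_level_small).
move=> z t zX; apply: energy_level_continues => //.
exact: (flow_continuous XM zX).
Qed.

Lemma energy_level_motion : gradient Pi 0 = 0 ->
  exists q p : R -> 'rV[R]_n, asymptotic_motion Omega H q p.
Proof.
move=> /energy_level_asymptotic[z [zX z0 zA z_lim]].
exists (fun t => (z t).1), (fun t => (z t).2); split.
- move=> t /= t0; have Az := zA t t0; have := zX t; rewrite level_field// => zt.
  split; first by have [zr _ _] := Az; exact: rO.
    by apply: is_derive_rV => i; have [] := zt i.
  by apply: is_derive_rV => i; have [] := zt i.
- have nz : 0 < `|z 0| by rewrite normr_gt0.
  have /cvgrPdist_lt/(_ _ nz)[m [_ mP]] := z_lim.
  (* Far in the past the orbit is closer to 0 than at time 0. *)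
  exists (Num.min (m - 1) 0), 0; split => //; first by rewrite ge_min lexx orbT.
  rewrite -!surjective_pairing => e; have := mP (Num.min (m - 1) 0).
  rewrite sub0r normrN e ltxx; suff -> : Num.min (m - 1) 0 < m by move=> /(_ isT).
  by rewrite gt_min ltrBlDr ltrDl ltr01.
- have -> : (fun t => ((z t).1, (z t).2)) = z.
    by apply/funext => t; rewrite -surjective_pairing.
  exact: z_lim.
Qed.

End EnergyLevel.

Unset Implicit Arguments.

(** * Existence of the asymptotic motion *)

Theorem proposition8 (R : realType) (n : nat) (Omega : set 'rV[R]_n)
    (B : 'rV[R]_n -> 'M[R]_n) (Pi : 'rV[R]_n -> R)
    (Omega_open : open Omega) (Omega0 : Omega 0)
    (B_sym : forall q, Omega q -> symmetric_mx (B q))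
    (B_pos : forall q, Omega q -> posdef_mx (B q))
    (T_C2 : class_C 2 (Omega `*` [set: 'rV[R]_n]) (kinetic B))
    (Pi_C2 : class_C 2 Omega Pi)
    (Pi0 : Pi 0 = 0) (Pi_crit : gradient Pi 0 = 0)
    (eps : R) (eps_gt0 : 0 < eps) (eball_Omega : eball eps `<=` Omega)
    (C : set 'rV[R]_n)
    (C_comp : is_component (Omega `&` [set q | Pi q < 0]) C)
    (C0 : closure C 0)
    (Pi_decr : forall q, ((closure C `\ 0) `&` eball eps) q ->
       dotv (gradient Pi q) q < 0) :
  exists q p : R -> 'rV[R]_n,
    asymptotic_motion Omega (hamiltonian B Pi) q p.
Proof.
(* The Euclidean norm is at most [sqrt n], so less than [n + 1], times the sup norm. *)
pose r1 := eps / n.+1%:R.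
have r10 : 0 < r1 by rewrite divr_gt0.
have eball1 (x : 'rV[R]_n) : `|x| <= r1 -> eball eps x by exact: eball_sup_norm.
have O1 (x : 'rV[R]_n) : `|x| <= r1 -> Omega x by move=> /eball1; exact: eball_Omega.
have [c [N [c0 N0 T_ge dT_le]]] := kinetic_bounds B_pos T_C2 O1.
(* The summand 1 makes [k] nonzero. *)
pose k := n%:R * N + 1.
have k0 : 0 < k by rewrite ltr_wpDl// mulr_ge0.
pose r := Num.min r1 (c / k).
have r0 : 0 < r by rewrite lt_min r10 divr_gt0.
have r_r1 (x : 'rV[R]_n) : `|x| <= r -> `|x| <= r1.
  by move=> /le_trans; apply; rewrite ge_min lexx.
have rO (x : 'rV[R]_n) : `|x| <= r -> Omega x by move=> /r_r1/O1.
have r_small : r * (n%:R * N) <= c.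
  apply: (@le_trans _ _ (r * k)); first by rewrite ler_wpM2l ?lerDl// ltW.
  by rewrite -ler_pdivlMr// ge_min lexx orbT.
have [P P0 PiP] : exists2 P : R, 0 <= P &
    forall x : 'rV[R]_n, `|x| <= r -> `|Pi x| <= P.
  apply: (@compact_bounded_cont R _ [set x : 'rV[R]_n | `|x| <= r]).
    exact: closed_ball_compact.
  by move=> x xr; exact/differentiable_continuous/(potential_differentiable Pi_C2)/rO.
(* As [b >= 1], [c b^2 >= c b = c + P > - Pi x]. *)
pose b := 1 + P / c.
have b1 : 1 <= b by rewrite lerDl divr_ge0// ltW.
have b0 : 0 < b by exact: lt_le_trans b1.
have b_large (x : 'rV[R]_n) : `|x| <= r -> - Pi x < c * b ^+ 2.
  move=> /PiP; rewrite -normrN => /(le_trans (ler_norm _)) h.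
  apply: le_lt_trans h _; apply: (@lt_le_trans _ _ (c * b)).
    have -> : c * b = c + P by rewrite /b; field; rewrite gt_eqF.
    by rewrite ltrDr.
  by rewrite ler_wpM2l ?(ltW c0)// expr2 ler_peMr// ltW.
apply: (@energy_level_motion R n Omega B Pi C r b c N) => //.
- by move=> q p /r_r1; exact: T_ge.
- by move=> q p i /r_r1; exact: dT_le.
- move=> q /r_r1/eball1 qe qC q0; apply: Pi_decr; split => //.
  by split => //; exact/eqP.
Qed.
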